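(* Let $\mathfrak{n}$ be a $6$-dimensional real vector space with basis $X_1,\dots,X_6$ and dual basis $\alpha_1,\dots,\alpha_6$, let $\omega=\alpha_1\wedge\alpha_6+\alpha_2\wedge\alpha_5+\alpha_3\wedge\alpha_4$, and let $\langle\cdot,\cdot\rangle$ be the inner product with $\langle X_i,X_j\rangle=\delta_{ij}$, which is compatible with $\omega$. For $a,b,c\in\mathbb{R}$ let $\mu=\mu(a,b,c)$ be the $2$-step nilpotent Lie bracket on $\mathfrak n$ whose only non-zero brackets, up to skew-symmetry, are $$\mu(X_1,X_2)=aX_4,\qquad \mu(X_1,X_3)=bX_5,\qquad \mu(X_2,X_3)=cX_6 .$$ Then: (i) $\omega$ is closed for $\mu(a,b,c)$ if and only if $a-b+c=0$. (ii) The anti-complexified Ricci operator is, in the basis $X_1,\dots,X_6$, $$\mathrm{Ric}^{ac}_\mu=-\tfrac14(a^2+b^2+c^2)\,\mathrm{diag}(1,1,1,-1,-1,-1)$$ $$=-\tfrac34(a^2+b^2+c^2)I+\tfrac12(a^2+b^2+c^2)\,\mathrm{diag}(1,1,1,2,2,2)\in\mathbb RI+\mathrm{Der}(\mu),$$ and so the whole family $\{[\mu(a,b,c)]: a-b+c=0\}\subset\mathbb P\mathcal N_s$ consists of critical points of $F$. (iii) Assume $a^2+b^2+c^2=2$ (equivalently, the scalar curvature is $-1$). The Ricci operator restricted to the center $\langle X_4,X_5,X_6\rangle_{\mathbb R}$ is $\frac12\mathrm{diag}(a^2,b^2,c^2)$, and thus the curve $$\{\mu_{st}=\mu(s,s+t,t):\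 s^2+st+t^2=1,\ 0\le t\le\tfrac1{\sqrt3}\}$$ is pairwise non-isometric. Consequently, $(N_{\mu_{st}},\omega)$ is a curve of pairwise non-isomorphic symplectic nilpotent Lie groups, and every symplectic structure in this curve admits a compatible metric which is minimal. (iv) $(\mathfrak n,\mu_{10})$ is isomorphic to the Lie algebra whose dual has a basis $e_1,\dots,e_6$ with $de_1=de_2=de_3=de_4=0$, $de_5=e_1\wedge e_2$, $de_6=e_1\wedge e_3$; and for any $0<t\le\frac1{\sqrt3}$, $(\mathfrak n,\mu_{st})$ is isomorphic to the Lie algebra whose dual has a basis $e_1,\dots,e_6$ with $de_1=de_2=de_3=0$, $de_4=e_1\wedge e_2$, $de_5=e_1\wedge e_3$, $de_6=e_2\wedge e_3$.
   Context: For a nilpotent Lie bracket $\mu$ on $\mathfrak n$, $N_\mu$ denotes the simply connected nilpotent Lie group with Lie algebra $(\mathfrak n,\mu)$, and $\mathrm{Der}(\mu)$ its algebra of derivations; forms and inner products on $\mathfrak n$ define left invariant structures on $N_\mu$. The form $\omega$ is closed for $\mu$ if $\omega(\mu(X,Y),Z)+\omega(\mu(Y,Z),X)+\omega(\mu(Z,X),Y)=0$ for all $X,Y,Z$; then $(N_\mu,\omega)$ is a symplectic nilpotent Lie group. $\mathcal N_s$ is the algebraic variety of all nilpotent Lie brackets on $\mathfrak n$ for which $\omega$ is closed, and $\mathbb P\mathcal N_s$ is its projectivization. Each $\mu\in\mathcal N_s$ is identified with $(N_\mu,\omega,\langle\cdot,\cdot\rangle)$, and ''isometric'' refers to the Riemannian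 manifolds $(N_\mu,\langle\cdot,\cdot\rangle)$. Two symplectic nilpotent Lie groups $(N_\mu,\omega)$, $(N_{\mu'},\omega')$ are isomorphic if there is a Lie algebra isomorphism $\varphi:(\mathfrak n,\mu)\to(\mathfrak n,\mu')$ with $\omega'(\varphi X,\varphi Y)=\omega(X,Y)$ for all $X,Y$. An inner product is compatible with $\omega$ if the endomorphism $J$ defined by $\omega(X,Y)=\langle X,JY\rangle$ satisfies $J^2=-I$. With $\mathrm{Ric}$ the Ricci operator of $(N_\mu,\langle\cdot,\cdot\rangle)$, the anti-complexified Ricci operator is $\mathrm{Ric}^{ac}=\frac12(\mathrm{Ric}+J\,\mathrm{Ric}\,J)$. The functional $F:\mathbb P\mathcal N_s\to\mathbb R$ is $F([\mu])=\operatorname{tr}(\mathrm{Ric}^{ac}_\mu)^2/\|\mu\|^4$, where $\|\mu\|^2=\sum_{i,j}\|\mu(X_i,X_j)\|^2$. A compatible metric is called minimal if it minimizes $\operatorname{tr}(\mathrm{Ric}^{ac})^2$ among all left invariant metrics compatible with $(N_\mu,\omega)$ having the same scalar curvature; $[\mu]$ is a critical point of $F$ if and only if $\mathrm{Ric}^{ac}_\mu\in\mathbb RI+\mathrm{Der}(\mu)$, if and only if $\langle\cdot,\cdot\rangle$ is minimal for $(N_\mu,\omega)$.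
   Formalization: ''Pairwise'' on the curve means for different t (the two roots s and -s-t for one t give isometric, symplectically isomorphic structures, e.g. (1,0),(-1,0)); that the center is the span of X4,X5,X6 is claimed only when a-b+c=0 (it fails at (√2,0,0)). *)

(* Defs.v *)
From HB Require Import structures.
From mathcomp Require Import all_boot all_order all_algebra.
From mathcomp Require Import all_classical all_reals all_analysis.
From mathcomp Require Import ring.

Set Implicit Arguments.
Unset Strict Implicit.
Unset Printing Implicit Defensive.

Import Order.TTheory GRing.Theory Num.Theory.
Import numFieldNormedType.Exports.

Local Open Scope classical_set_scope.
Local Open Scope ring_scope.

(* The space n is 'rV[R]_6 with its standard basis, numbered from 1.  An      *)
(* endomorphism of n is a matrix acting on row vectors from the right, so     *)
(* that the composite A \o B is the matrix product B *m A.                    *)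

Section Basis.
Variable R : realType.

Definition X (i : nat) : 'rV[R]_6 := delta_mx 0 (inord i.-1).

Definition alpha (i : nat) (x : 'rV[R]_6) : R := x 0 (inord i.-1).

Definition wedge (f g : 'rV[R]_6 -> R) (x y : 'rV[R]_6) : R :=
  f x * g y - f y * g x.

Definition diag6 (s : seq R) : 'M[R]_6 := diag_mx (\row_(j < 6) s`_j).

End Basis.
Arguments X {R} i.
Arguments alpha {R} i x.

Section Brackets.
Variable R : realType.
Implicit Types (mu nu : 'rV[R]_6 -> 'rV[R]_6 -> 'rV[R]_6).
Implicit Types (om : 'rV[R]_6 -> 'rV[R]_6 -> R).

Definition lie_bracket mu : Prop :=
  [/\ forall y, linear (mu^~ y),
      forall x, linear (mu x),
      forall x, mu x x = 0 &
      forall x y z, mu x (mu y z) + mu y (mu z x) + mu z (mu x y) = 0].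

(* The brackets [x_1, [x_2, ..., [x_k, y]]] span the k-th term of the lower   *)
(* central series.                                                            *)
Definition nilpotent mu : Prop :=
  exists k, forall (s : seq 'rV[R]_6) y, size s = k -> foldr mu y s = 0.

Definition closed_form om mu : Prop :=
  forall x y z, om (mu x y) z + om (mu y z) x + om (mu z x) y = 0.

Definition Ns om mu : Prop :=
  [/\ lie_bracket mu, nilpotent mu & closed_form om mu].

Definition lie_center mu : set 'rV[R]_6 := [set x | forall y, mu x y = 0].

Definition derivation mu (D : 'M[R]_6) : Prop :=
  forall x y, mu x y *m D = mu (x *m D) y + mu x (y *m D).

Definition in_RI_plus_Der mu (A : 'M[R]_6) : Prop :=
  exists (c : R) (D : 'M[R]_6), derivation mu D /\ A = c%:M + D.

Definition lie_isomorphic mu nu : Prop :=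
  exists2 phi : 'M[R]_6, phi \in unitmx &
    forall x y, mu x y *m phi = nu (x *m phi) (y *m phi).

Definition symplectic_isomorphic mu om nu om' : Prop :=
  exists2 phi : 'M[R]_6, phi \in unitmx &
    (forall x y, mu x y *m phi = nu (x *m phi) (y *m phi)) /\
    (forall x y, om' (x *m phi) (y *m phi) = om x y).

(* Exterior derivative of a left invariant 1-form.                            *)
Definition d1 mu (f : 'rV[R]_6 -> R) (x y : 'rV[R]_6) : R := - f (mu x y).

(* The linear forms e_1, ..., e_6 given by the columns of E; they are a basis *)
(* of the dual space exactly when E is invertible.                            *)
Definition covec (E : 'M[R]_6) (i : nat) (x : 'rV[R]_6) : R := alpha i (x *m E).

End Brackets.

(* A left invariant metric is given by its Gram matrix G in the basis X.      *)
Section Metrics.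
Variable R : realType.
Implicit Types (mu : 'rV[R]_6 -> 'rV[R]_6 -> 'rV[R]_6).
Implicit Types (om : 'rV[R]_6 -> 'rV[R]_6 -> R).
Implicit Types (G A : 'M[R]_6) (x y z : 'rV[R]_6).

Definition ip G x y : R := (x *m G *m y^T) 0 0.

Definition inner_product G : Prop :=
  G^T = G /\ forall x, x != 0 -> 0 < ip G x x.

(* Levi-Civita connection on left invariant fields (Koszul formula): the      *)
(* vector v with                                                              *)
(* 2 <v, z> = <[x, y], z> - <[y, z], x> + <[z, x], y> for all z.              *)
Definition nabla mu G x y : 'rV[R]_6 :=
  (\row_(k < 6) (2^-1 * (ip G (mu x y) (delta_mx 0 k)
                         - ip G (mu y (delta_mx 0 k)) x
                         + ip G (mu (delta_mx 0 k) x) y))) *m invmx G.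

Definition curvature mu G x y z : 'rV[R]_6 :=
  nabla mu G x (nabla mu G y z) - nabla mu G y (nabla mu G x z)
  - nabla mu G (mu x y) z.

Definition ricci_tensor mu G y z : R :=
  \tr (lin1_mx (fun x => curvature mu G x y z)).

(* <Ric x, y> = ricci_tensor x y                                              *)
Definition Ric mu G : 'M[R]_6 :=
  (\matrix_(i < 6, j < 6) ricci_tensor mu G (delta_mx 0 i) (delta_mx 0 j))
  *m invmx G.

Definition scal mu G : R := \tr (Ric mu G).

Definition form_mx om : 'M[R]_6 :=
  \matrix_(i < 6, j < 6) om (delta_mx 0 i) (delta_mx 0 j).

(* The endomorphism J with om x y = <x, J y>; see JmxP.                       *)
Definition Jmx om G : 'M[R]_6 := (invmx G *m form_mx om)^T.

Definition compatible om G : Prop :=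
  inner_product G /\ Jmx om G *m Jmx om G = - 1%:M.

Definition Ric_ac om mu G : 'M[R]_6 :=
  2^-1 *: (Ric mu G + Jmx om G *m Ric mu G *m Jmx om G).

Definition tr_sq A : R := \tr (A *m A).

Definition minimal om mu G : Prop :=
  compatible om G /\
  forall G', compatible om G' -> scal mu G' = scal mu G ->
    tr_sq (Ric_ac om mu G) <= tr_sq (Ric_ac om mu G').

(* The fixed inner product, for which X is orthonormal.                       *)
Definition ip0 : 'M[R]_6 := 1%:M.

Definition normsq mu : R :=
  \sum_(i < 6) \sum_(j < 6)
    ip ip0 (mu (delta_mx 0 i) (delta_mx 0 j)) (mu (delta_mx 0 i) (delta_mx 0 j)).

Definition F om mu : R := tr_sq (Ric_ac om mu ip0) / normsq mu ^+ 2.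

(* Points of the projectivized variety PNs are represented by nonzero         *)
(* brackets; F is invariant under rescaling (FZ).  As Ns may be singular,     *)
(* [mu] is critical for F on PNs when F has zero derivative at mu along every *)
(* curve in Ns \ {0} through mu which is differentiable there.                *)
Definition in_PNs om mu : Prop := Ns om mu /\ mu <> (fun _ _ => 0).

Definition critical_point om mu : Prop :=
  in_PNs om mu /\
  forall c : R -> 'rV[R]_6 -> 'rV[R]_6 -> 'rV[R]_6,
    c 0 = mu ->
    (\forall r \near nbhs (0 : R), in_PNs om (c r)) ->
    (forall x y, derivable (fun r => c r x y) 0 1) ->
    is_derive (0 : R) (1 : R) (fun r => F om (c r)) 0.

End Metrics.
Arguments ip0 {R}.

Section Smooth.
Variable R : realType.

Fixpoint Ck (V W : normedModType R) (k : nat) (f : V -> W) : Prop :=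
  match k with
  | 0 => continuous f
  | k'.+1 => (forall x, differentiable f x) /\
             forall v, Ck k' (fun x => 'D_v f x)
  end.

Definition smooth (V W : normedModType R) (f : V -> W) : Prop :=
  forall k, Ck k f.

End Smooth.

Section SmoothTheory.
Variables (R : realType) (V : normedModType R).

Lemma CkS (W : normedModType R) k (f : V -> W) : Ck k.+1 f -> Ck k f.
Proof.
elim: k f => [|k IH] f [df Df]; first by move=> x; exact: differentiable_continuous.
by split=> // v; exact: IH.
Qed.

Lemma Ck_cst (W : normedModType R) k (w : W) : Ck k (fun _ : V => w).
Proof.
elim: k w => [|k IH] w /=; first by move=> x; exact: cst_continuous.
split=> [x|v]; first exact: differentiable_cst.
rewrite (_ : (fun x => 'D_v _ x) = (fun _ => 0)); last first.
  by apply/funext => x; exact: derive_cst.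
exact: IH.
Qed.

Lemma CkD (W : normedModType R) k (f g : V -> W) :
  Ck k f -> Ck k g -> Ck k (fun x => f x + g x).
Proof.
elim: k f g => [|k IH] f g /=; first by move=> cf cg x; exact: (continuousD (cf x) (cg x)).
move=> [df Df] [dg Dg]; split=> [x|v]; first exact: differentiableD.
rewrite (_ : (fun x => 'D_v _ x) = (fun x => 'D_v f x + 'D_v g x)).
  exact: (IH _ _ (Df v) (Dg v)).
by apply/funext => x; rewrite deriveD //; exact: diff_derivable.
Qed.

Lemma CkM k (f g : V -> R) : Ck k f -> Ck k g -> Ck k (fun x => f x * g x).
Proof.
elim: k f g => [|k IH] f g; first by move=> cf cg x; exact: (continuousM (cf x) (cg x)).
move=> cf cg; have [df Df] := cf; have [dg Dg] := cg.
split=> [x|v]; first exact: differentiableM.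
rewrite (_ : (fun x => 'D_v _ x) = (fun x => f x * 'D_v g x + g x * 'D_v f x)).
  apply: CkD; apply: IH; [exact: (CkS cf)|exact: (Dg v)|exact: (CkS cg)|exact: (Df v)].
by apply/funext => x; rewrite deriveM //; exact: diff_derivable.
Qed.

Lemma CkZl (W : normedModType R) k (f : V -> R) (w : W) :
  Ck k f -> Ck k (fun x => f x *: w).
Proof.
elim: k f => [|k IH] f; first by move=> cf x; exact: (@continuousZr_tmp _ _ _ f w x (cf x)).
move=> [df Df]; split=> [x|v]; first by apply: differentiableZl.
rewrite (_ : (fun x => 'D_v _ x) = (fun x => 'D_v f x *: w)); first exact: (IH _ (Df v)).
apply/funext => x; rewrite !deriveE //; last exact: differentiableZl.
by rewrite diffZl.
Qed.

Lemma Ck_lin (W : normedModType R) k (f : {linear V -> W}) :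
  continuous f -> Ck k f.
Proof.
case: k => [//|k] cf; split=> [x|v]; first exact: linear_differentiable.
rewrite (_ : (fun x => 'D_v _ x) = (fun _ => f v)); first exact: Ck_cst.
apply/funext => x; rewrite deriveE; last exact: linear_differentiable.
by rewrite diff_lin.
Qed.

Lemma Ck_sum (W : normedModType R) k (I : Type) (r : seq I) (f : I -> V -> W) :
  (forall i, Ck k (f i)) -> Ck k (fun x => \sum_(i <- r) f i x).
Proof.
move=> cf; elim: r => [|i r IH].
  by rewrite (_ : (fun x => _) = (fun _ => 0)); [exact: Ck_cst|apply/funext=> x; rewrite big_nil].
rewrite (_ : (fun x => _) = (fun x => f i x + \sum_(j <- r) f j x)); first exact: CkD.
by apply/funext => x; rewrite big_cons.
Qed.

Lemma derive_affine (W : normedModType R) (f : V -> W) x u w :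
  (forall h : R, f (h *: u + x) - f x = h *: w) -> 'D_u f x = w.
Proof.
move=> fE; apply: cvg_lim => //.
apply: (@cvg_trans _ ((fun _ : R => w) @ 0^')); last exact: cvg_cst.
apply: near_eq_cvg; near=> h.
rewrite /= fE scalerA mulVf ?scale1r //.
by near: h; exact: nbhs_dnbhs_neq.
Unshelve. all: by end_near. Qed.

End SmoothTheory.

(* A simply connected nilpotent Lie group is diffeomorphic to its Lie algebra *)
(* via exp, so the groups N_mu are modelled as Lie group structures on the    *)
(* manifold 'rV[R]_6, each tangent space being identified with 'rV[R]_6.      *)
Record lie_group (R : realType) := LieGroup {
  lg_mul : 'rV[R]_6 -> 'rV[R]_6 -> 'rV[R]_6;
  lg_one : 'rV[R]_6;
  lg_inv : 'rV[R]_6 -> 'rV[R]_6;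
  lg_mulA : associative lg_mul;
  lg_mul1 : left_id lg_one lg_mul;
  lg_1mul : right_id lg_one lg_mul;
  lg_mulV : left_inverse lg_one lg_inv lg_mul;
  lg_Vmul : right_inverse lg_one lg_inv lg_mul;
  lg_smooth_mul :
    smooth (fun p : 'rV[R]_6 * 'rV[R]_6 => lg_mul p.1 p.2);
  lg_smooth_inv : smooth lg_inv
}.

Section LieGroups.
Variable R : realType.
Implicit Types (N : lie_group R) (mu nu : 'rV[R]_6 -> 'rV[R]_6 -> 'rV[R]_6).
Implicit Types (G : 'M[R]_6) (x u v : 'rV[R]_6).

Definition left_field N u x : 'rV[R]_6 := 'D_u (lg_mul N x) (lg_one N).

(* Value at the identity of the commutator of left invariant vector fields.   *)
Definition lg_bracket N u v : 'rV[R]_6 :=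
  'D_u (left_field N v) (lg_one N) - 'D_v (left_field N u) (lg_one N).

Definition has_lie_algebra N mu : Prop :=
  forall u v, lg_bracket N u v = mu u v.

(* Left invariant Riemannian metric extending G: translate the tangent        *)
(* vectors u, v at x back to the identity.                                    *)
Definition left_metric N G x u v : R :=
  ip G ('D_u (lg_mul N (lg_inv N x)) x) ('D_v (lg_mul N (lg_inv N x)) x).

Definition riemannian_isometry N G N' G' (f : 'rV[R]_6 -> 'rV[R]_6) : Prop :=
  [/\ smooth f,
      exists h, [/\ smooth h, cancel f h & cancel h f] &
      forall x u v,
        left_metric N' G' (f x) ('D_u f x) ('D_v f x) = left_metric N G x u v].

(* (N_mu, G) and (N_nu, G') are isometric.  N_mu is unique up to an           *)
(* isomorphism with differential the identity, hence up to isometry; see      *)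
(* two_step_lie_group for its existence when mu is 2-step.                    *)
Definition isometric mu G nu G' : Prop :=
  exists N N' : lie_group R,
    [/\ has_lie_algebra N mu, has_lie_algebra N' nu &
        exists f, riemannian_isometry N G N' G' f].

End LieGroups.

Section Sanity.
Variable R : realType.
Implicit Types (mu : 'rV[R]_6 -> 'rV[R]_6 -> 'rV[R]_6).

Lemma linear_sumE (f : 'rV[R]_6 -> 'rV[R]_6) (x : 'rV[R]_6) :
  linear f -> f x = \sum_i x 0 i *: f (delta_mx 0 i).
Proof.
move=> lf; pose fM := GRing.isLinear.Build _ _ _ _ f lf.
pose fL : {linear 'rV[R]_6 -> 'rV[R]_6} := HB.pack f fM.
rewrite -[f]/(fL : _ -> _) {1}(row_sum_delta x) linear_sum.
by apply: eq_bigr => i _; rewrite linearZ.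
Qed.

Lemma two_step_lie_group mu :
  lie_bracket mu -> (forall x y z, mu x (mu y z) = 0) ->
  exists N, has_lie_algebra N mu.
Proof.
move=> [linl linr alt _] two.
have addl x y z : mu (x + y) z = mu x z + mu y z.
  by have := linl z 1 x y; rewrite !scale1r.
have addr x y z : mu x (y + z) = mu x y + mu x z.
  by have := linr x 1 y z; rewrite !scale1r.
have m0l x : mu 0 x = 0 by have := linl x (-1) 0 0; rewrite scaler0 addr0 scaleN1r addNr.
have m0r x : mu x 0 = 0 by have := linr x (-1) 0 0; rewrite scaler0 addr0 scaleN1r addNr.
have scl k x y : mu (k *: x) y = k *: mu x y.
  by have := linl y k x 0; rewrite !addr0 m0l addr0.
have scr k x y : mu x (k *: y) = k *: mu x y.
  by have := linr x k y 0; rewrite !addr0 m0r addr0.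
have anti x y : mu y x = - mu x y.
  have := alt (x + y); rewrite addl !addr !alt addr0 add0r => /eqP.
  by rewrite addrC addr_eq0 => /eqP.
have two' x y z : mu (mu x y) z = 0 by rewrite anti two oppr0.
pose m x y := x + y + 2^-1 *: mu x y.
pose i (x : 'rV[R]_6) := - x.
have mA : associative m.
  move=> x y z; rewrite /m !addl !addr !scl !scr two two' !scaler0 !addr0.
  by apply/rowP => k; rewrite !mxE; ring.
have ml : left_id 0 m by move=> x; rewrite /m m0l scaler0 addr0 add0r.
have mr : right_id 0 m by move=> x; rewrite /m m0r scaler0 !addr0.
have mN x : mu (- x) x = 0 by rewrite -scaleN1r scl alt scaler0.
have mV : left_inverse 0 i m by move=> x; rewrite /m /i mN scaler0 addNr addr0.
have Vm : right_inverse 0 i m.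
  by move=> x; rewrite /m /i anti mN oppr0 scaler0 subrr addr0.
have sm : smooth (fun p : 'rV[R]_6 * 'rV[R]_6 => m p.1 p.2).
  move=> k; rewrite /m.
  have c1 : continuous (fst : 'rV[R]_6 * 'rV[R]_6 -> 'rV[R]_6) by move=> p; exact: cvg_fst.
  have c2 : continuous (snd : 'rV[R]_6 * 'rV[R]_6 -> 'rV[R]_6) by move=> p; exact: cvg_snd.
  have lc (f : {linear ('rV[R]_6 * 'rV[R]_6)%type -> 'rV[R]_6}) j :
      continuous f -> Ck k (fun p => f p 0 j).
    move=> cf; have lf : linear (fun p => f p 0 j : R).
      by move=> a p q; rewrite linearP !mxE.
    pose gM := GRing.isLinear.Build _ _ _ _ (fun p => f p 0 j : R) lf.
    pose g : {linear ('rV[R]_6 * 'rV[R]_6)%type -> R} := HB.pack (fun p => f p 0 j : R) gM.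
    apply: (@Ck_lin _ _ _ k g) => p.
    apply: (@continuous_comp _ _ _ f (fun M : 'rV[R]_6 => M 0 j)); first exact: cf.
    exact: coord_continuous.
  apply: CkD; first by apply: CkD; exact: Ck_lin.
  rewrite (_ : (fun x => _) = fun p : 'rV[R]_6 * 'rV[R]_6 =>
    \sum_a \sum_b (p.1 0 a * p.2 0 b) *: (2^-1 *: mu (delta_mx 0 a) (delta_mx 0 b))).
    apply: Ck_sum => a; apply: Ck_sum => b.
    apply: (@CkZl _ _ _ k (fun p : 'rV[R]_6 * 'rV[R]_6 => p.1 0 a * p.2 0 b)).
    apply: (@CkM _ _ k (fun p : 'rV[R]_6 * 'rV[R]_6 => p.1 0 a)
                       (fun p : 'rV[R]_6 * 'rV[R]_6 => p.2 0 b)).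
      exact: (lc fst a c1).
    exact: (lc snd b c2).
  apply/funext => -[x y] /=.
  rewrite (@linear_sumE (mu^~ y)) // scaler_sumr; apply: eq_bigr => a _.
  rewrite (@linear_sumE (mu _)) // !scaler_sumr; apply: eq_bigr => b _.
  by rewrite !scalerA; congr (_ *: _); ring.
have si : smooth i.
  move=> k; apply: (@Ck_lin _ _ _ k (-%R : {linear 'rV[R]_6 -> 'rV[R]_6})).
  by move=> x; exact: opp_continuous.
exists (LieGroup mA ml mr mV Vm sm si) => u v; rewrite /lg_bracket /=.
have lfE w x : left_field (LieGroup mA ml mr mV Vm sm si) w x = w + 2^-1 *: mu x w.
  apply: derive_affine => h /=; rewrite /m !addr0 m0r scaler0 addr0 scr.
  by apply/rowP => k; rewrite !mxE; ring.
have dE w z : 'D_w (left_field (LieGroup mA ml mr mV Vm sm si) z) 0 = 2^-1 *: mu w z.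
  apply: derive_affine => h; rewrite !lfE addr0 m0l scaler0 addr0 scl.
  by apply/rowP => k; rewrite !mxE; ring.
transitivity (2^-1 *: mu u v - 2^-1 *: mu v u).
  by congr (_ - _); exact: dE.
rewrite (anti u v) scalerN opprK -scalerDl.
by rewrite -[2^-1]mul1r -splitr scale1r.
Qed.

Lemma pos_unitmx (G : 'M[R]_6) : inner_product G -> G \in unitmx.
Proof.
move=> [_ Gpos]; rewrite -row_free_unit -kermx_eq0.
apply/eqP/row_matrixP => k; rewrite row0.
apply/eqP; apply: contraT => /Gpos.
by rewrite /ip -row_mul mulmx_ker row0 mul0mx mxE ltxx.
Qed.

Lemma JmxP (om : 'rV[R]_6 -> 'rV[R]_6 -> R) G x y :
  (forall z, linear (om z : 'rV[R]_6 -> R^o)) ->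
  (forall z, linear (om^~ z : 'rV[R]_6 -> R^o)) ->
  inner_product G -> om x y = ip G x (y *m Jmx om G).
Proof.
move=> linr linl Gip; rewrite /ip /Jmx trmx_mul trmxK mulmxA.
rewrite mulmxA mulmxK ?pos_unitmx // mxE.
pose f1 z := GRing.isLinear.Build _ _ _ _ (om z : 'rV[R]_6 -> R^o) (linr z).
pose g1 z : {linear 'rV[R]_6 -> R^o} := HB.pack (om z : 'rV[R]_6 -> R^o) (f1 z).
pose f2 z := GRing.isLinear.Build _ _ _ _ (om^~ z : 'rV[R]_6 -> R^o) (linl z).
pose g2 z : {linear 'rV[R]_6 -> R^o} := HB.pack (om^~ z : 'rV[R]_6 -> R^o) (f2 z).
rewrite {1}(row_sum_delta y) -[LHS]/(g1 x _) linear_sum; apply: eq_bigr => j _.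
rewrite linearZ !mxE mulrC; congr (_ * _).
rewrite -[LHS]/(g2 (delta_mx 0 j) x) {1}(row_sum_delta x) linear_sum.
by apply: eq_bigr => i _; rewrite linearZ !mxE.
Qed.

Lemma FZ om mu k : k != 0 -> lie_bracket mu ->
  F om (fun x y => k *: mu x y) = F om mu.
Proof.
move=> k0 [linl linr _ _]; set nu := fun x y => k *: mu x y.
have ipl c x y : ip ip0 (c *: x) y = c * ip ip0 x y.
  by rewrite /ip -!scalemxAl mxE.
have ipr c x y : ip ip0 x (c *: y) = c * ip ip0 x y.
  by rewrite /ip linearZ /= -scalemxAr mxE.
have m0l x : mu 0 x = 0 by have := linl x (-1) 0 0; rewrite scaler0 addr0 scaleN1r addNr.
have m0r x : mu x 0 = 0 by have := linr x (-1) 0 0; rewrite scaler0 addr0 scaleN1r addNr.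
have scl c x y : mu (c *: x) y = c *: mu x y.
  by have := linl y c x 0; rewrite !addr0 m0l addr0.
have scr c x y : mu x (c *: y) = c *: mu x y.
  by have := linr x c y 0; rewrite !addr0 m0r addr0.
have nE x y : nabla nu ip0 x y = k *: nabla mu ip0 x y.
  rewrite /nabla scalemxAl; congr (_ *m _); apply/rowP => j; rewrite !mxE !ipl; ring.
have nl c x y : nabla mu ip0 (c *: x) y = c *: nabla mu ip0 x y.
  rewrite /nabla scalemxAl; congr (_ *m _); apply/rowP => j.
  rewrite !mxE ?(scl, scr) ?(ipl, ipr); ring.
have nr c x y : nabla mu ip0 x (c *: y) = c *: nabla mu ip0 x y.
  rewrite /nabla scalemxAl; congr (_ *m _); apply/rowP => j.
  rewrite !mxE ?(scl, scr) ?(ipl, ipr); ring.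
have cE x y z : curvature nu ip0 x y z = k ^+ 2 *: curvature mu ip0 x y z.
  by rewrite /curvature !nE !nr /nu nl !scalerBr !scalerA expr2.
have rE x y : ricci_tensor nu ip0 x y = k ^+ 2 * ricci_tensor mu ip0 x y.
  rewrite /ricci_tensor -mxtraceZ; congr (\tr _); apply/matrixP => i j.
  by rewrite mxE cE !mxE.
have RE : Ric nu ip0 = k ^+ 2 *: Ric mu ip0.
  by rewrite /Ric scalemxAl; congr (_ *m _); apply/matrixP => i j; rewrite !mxE rE.
have aE : Ric_ac om nu ip0 = k ^+ 2 *: Ric_ac om mu ip0.
  by rewrite /Ric_ac RE -scalemxAr -scalemxAl -scalerDr !scalerA mulrC.
have tE : tr_sq (Ric_ac om nu ip0) = k ^+ 4 * tr_sq (Ric_ac om mu ip0).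
  by rewrite /tr_sq aE -scalemxAl -scalemxAr scalerA mxtraceZ -exprD.
have sE : normsq nu = k ^+ 2 * normsq mu.
  rewrite /normsq mulr_sumr; apply: eq_bigr => i _; rewrite mulr_sumr.
  by apply: eq_bigr => j _; rewrite /nu ipl ipr mulrA expr2.
have gen p q : k ^+ 4 * p / (k ^+ 2 * q) ^+ 2 = p / q ^+ 2.
  by rewrite exprMn -exprM invfM mulrACA mulfV ?mul1r // expf_neq0.
exact: etrans (congr2 (fun p q => p / q ^+ 2) tE sE) (gen _ _).
Qed.

End Sanity.

Section Family.
Variable R : realType.

Definition omega (x y : 'rV[R]_6) : R :=
  wedge (alpha 1) (alpha 6) x y + wedge (alpha 2) (alpha 5) x y
  + wedge (alpha 3) (alpha 4) x y.

Definition mu_abc (a b c : R) (x y : 'rV[R]_6) : 'rV[R]_6 :=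
  (a * wedge (alpha 1) (alpha 2) x y) *: X 4
  + (b * wedge (alpha 1) (alpha 3) x y) *: X 5
  + (c * wedge (alpha 2) (alpha 3) x y) *: X 6.

Definition mu_st (s t : R) := mu_abc s (s + t) t.

Definition on_curve (s t : R) : Prop :=
  s ^+ 2 + s * t + t ^+ 2 = 1 /\ 0 <= t <= (Num.sqrt 3)^-1.

End Family.
Arguments omega {R} x y.

(* Main.v *)
Require Import Defs.
From HB Require Import structures.
From mathcomp Require Import all_boot all_order all_algebra.
From mathcomp Require Import all_classical all_reals all_analysis.
From mathcomp Require Import ring lra zify.

Import Order.TTheory GRing.Theory Num.Theory.
Import numFieldNormedType.Exports.

Local Open Scope classical_set_scope.
Local Open Scope ring_scope.

Set Implicit Arguments.
Unset Strict Implicit.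
Unset Printing Implicit Defensive.

(** Everything is read off the Ricci operator of a nilpotent bracket for which
    the basis is orthonormal; with structure constants c,
      Ric_ij = - 1/2 sum_kl c_ikl c_jkl + 1/4 sum_kl c_kli c_klj.

    Critical points: along a curve through mu_abc, the numerator of F is
    2 tr (rho Ric) up to a constant and a term vanishing to second order, where
    rho = Ric^ac at mu_abc is a multiple of diag (1, 1, 1, -1, -1, -1), and the
    quadratic form tr (rho Ric) is proportional to the squared norm to first
    order at mu_abc.

    Minimality: the span z of X_4, X_5, X_6 is Lagrangian, central, and contains
    the derived algebra.  For any compatible metric let E be +1 on the
    orthogonal complement of z and -1 on z.  Then J E J = E and
    tr (Ric^ac E) = tr (Ric E) = 3 scal, so Cauchy-Schwarz gives
    tr (Ric^ac)^2 >= 3/2 scal^2, with equality for the standard metric.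

    Isometries: a Lie group with Lie algebra mu carries a Maurer-Cartan form
    theta with d theta = - mu (theta, theta).  An isometry f pulls theta' back to
    theta A with A orthogonal-valued, and the Koszul formula turns the structure
    equations into D_u A = C (theta u) A - A C' (theta u A), where C and C' are
    the Levi-Civita connections.  The symmetry of the second derivatives of A is
    then the equality of the curvatures up to A, so the Ricci operators are
    conjugate, and tr Ric^3 determines t on the curve.

    Symplectic isomorphisms: omega (mu (x, y), z) only involves the first three
    coordinates, hence is a 3 x 3 matrix M = diag (c, -b, a), and an isomorphism
    yields M = cof P M' P^T for some P.  Hence tr M^2 and tr M^3 are multiplied by
    (det P)^2 and (det P)^3, and they determine t. *)

(** * Symmetry of second derivatives *)

Section Calculus.
Variable R : realType.

Section Schwarz.
Variable V : normedModType R.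

(** Turns a directional derivative into a one-variable one, so that the mean value theorem applies
    along a line. *)
Lemma is_derive_line (f : V -> R) (x u : V) (s : R) :
  derivable f (s *: u + x) u ->
  is_derive s 1 (fun r => f (r *: u + x)) ('D_u f (s *: u + x)).
Proof.
move=> df.
have E : (fun h : R => h^-1 *: (f ((h *: 1 + s) *: u + x) - f (s *: u + x))) =
         (fun h : R => h^-1 *: (f (h *: u + (s *: u + x)) - f (s *: u + x))).
  by apply/funext => h; rewrite scalerDl [h *: 1]mulr1 addrA.
split; first by rewrite /derivable /= E.
by rewrite /derive /= E.
Qed.

Lemma differentiable_near (f : V -> R) (x : V) : differentiable f x ->
  forall e, 0 < e ->
  \forall w \near (0 : V), `|f (w + x) - f x - 'd f x w| <= e * `|w|.
Proof.
move=> df e e0; have /eqaddoP/(_ e e0) := diff_locally df.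
by apply: filterS => w /=; rewrite opprD addrA.
Qed.

(* The second difference of f along h u, h v is h^2 D_v D_u f + o(h^2), by the
   mean value theorem along u and the differentiability of D_u f at x. *)
Lemma second_difference (f : V -> R) (x u v : V) :
  (forall y, derivable f y u) -> differentiable ('D_u f) x ->
  forall e, 0 < e -> exists2 d, 0 < d & forall h, 0 < h < d ->
    `|f (h *: u + (h *: v + x)) - f (h *: u + x) - f (h *: v + x) + f x
      - h ^+ 2 * 'D_v ('D_u f) x| <= e * h ^+ 2.
Proof.
move=> fu dg e e0.
(* [K] dominates [|u| + |v|]; the added 1 keeps it positive when both vectors vanish. *)
set K := 2 * (`|u| + `|v|) + 1.
have K0 : 0 < K by rewrite /K; have := normr_ge0 u; have := normr_ge0 v; lra.
have eK0 : 0 < e / K / 2 by rewrite !divr_gt0.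
have /nbhs_ballP [d /= d0 Hd] := differentiable_near dg eK0.
exists (d / K); first by rewrite divr_gt0.
move=> h /andP[h0 hd].
(* The second difference is [ph h - ph 0], hence [dph c * h] for some [c] between 0 and [h]. *)
pose ph (s : R) : R := f (s *: u + (h *: v + x)) - f (s *: u + x).
pose dph (s : R) : R := 'D_u f (s *: u + (h *: v + x)) - 'D_u f (s *: u + x).
have phD (s : R) : is_derive (s : R) (1 : R) ph (dph s).
  by apply: is_deriveB; apply: is_derive_line.
have phC : {within `[0, h], continuous ph}.
  by apply: derivable_within_continuous => s _; exact: (@ex_derive _ _ _ _ _ _ _ (phD s)).
have [c cI] := @MVT R ph dph 0 h h0 (fun s _ => phD s) phC.
rewrite subr0 => E.
have -> : f (h *: u + (h *: v + x)) - f (h *: u + x) - f (h *: v + x) + f x =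
    ph h - ph 0 by rewrite /ph !scale0r !add0r; ring.
rewrite E /dph; move: cI; rewrite in_itv /= => /andP[c0 ch].
have bnd (a b : R) : 0 <= a <= h -> 0 <= b <= h -> `|a *: u + b *: v| <= h * K.
  move=> /andP[a0 ah] /andP[b0 bh].
  rewrite (le_trans (ler_normD _ _)) // !normrZ !ger0_norm //.
  have := ler_wpM2r (normr_ge0 u) ah; have := ler_wpM2r (normr_ge0 v) bh.
  have := mulr_ge0 (ltW h0) (normr_ge0 u); have := mulr_ge0 (ltW h0) (normr_ge0 v).
  rewrite /K; lra.
have small (a b : R) : 0 <= a <= h -> 0 <= b <= h ->
    `|'D_u f (a *: u + b *: v + x) - 'D_u f x - 'd ('D_u f) x (a *: u + b *: v)|
      <= e / 2 * h.
  move=> ai bi; have B := bnd _ _ ai bi.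
  apply: le_trans (Hd _ _) _.
    rewrite -ball_normE /= sub0r normrN (le_lt_trans B) //.
    by rewrite -ltr_pdivlMr.
  apply: le_trans (ler_wpM2l (ltW eK0) B) _.
  by rewrite le_eqVlt; apply/orP; left; apply/eqP; field; rewrite gt_eqF.
have c0h : 0 <= c <= h by rewrite !ltW.
have hh : 0 <= h <= h by rewrite ltW //=.
have zh : 0 <= (0 : R) <= h by rewrite lexx ltW.
have := small _ _ c0h hh; have := small _ _ c0h zh.
rewrite (deriveE v dg).
have L (a b : R) : 'd ('D_u f) x (a *: u + b *: v) =
    a * 'd ('D_u f) x u + b * 'd ('D_u f) x v by rewrite linearD !linearZ.
rewrite !L scale0r addr0 mul0r addr0 -(addrA (c *: u)).
set A := 'D_u f _; set B := 'D_u f x; set C := 'D_u f _; set Du := 'd _ _ u; set Dv := 'd _ _ v.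
move=> H1 H2.
(* The expansions at [c *: u + h *: v] and at [c *: u] share the term [c * Du]; their difference
   leaves [h * Dv] and two errors of size at most [e / 2 * h]. *)
have -> : (C - A) * h - h ^+ 2 * Dv =
  h * ((C - B - (c * Du + h * Dv)) - (A - B - c * Du)).
  ring.
rewrite normrM (gtr0_norm h0) expr2 mulrCA ler_pM2l //.
rewrite (le_trans (ler_normB _ _)) //.
have := lerD H2 H1; lra.
Qed.

(** The second difference is symmetric in [u] and [v], and divided by [h ^+ 2] it approximates both
    mixed derivatives. *)
Lemma schwarz (f : V -> R) (x u v : V) :
  (forall y, derivable f y u) -> (forall y, derivable f y v) ->
  differentiable ('D_u f) x -> differentiable ('D_v f) x ->
  'D_v ('D_u f) x = 'D_u ('D_v f) x.
Proof.
move=> fu fv du dv; apply/eqP; rewrite -subr_eq0 -normr_le0.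
apply/ler_addgt0Pl => e e0; rewrite addr0.
have e20 : 0 < e / 2 by rewrite divr_gt0.
have [d1 d10 H1] := second_difference v fu du e20.
have [d2 d20 H2] := second_difference u fv dv e20.
pose h := Num.min d1 d2 / 2.
have m0 : 0 < Num.min d1 d2 by rewrite lt_min d10.
have h0 : 0 < h by rewrite /h divr_gt0.
have hm : h < Num.min d1 d2 by rewrite /h; lra.
have h1 : 0 < h < d1 by rewrite h0; move: hm; rewrite lt_min => /andP[].
have h2 : 0 < h < d2 by rewrite h0; move: hm; rewrite lt_min => /andP[].
have h20 : 0 < h ^+ 2 by rewrite exprn_gt0.
move: (H1 _ h1) (H2 _ h2); rewrite [h *: v + (h *: u + x)]addrCA.
set a := f _; set b := f _; set c := f _; set p := 'D_v _ _; set q := 'D_u _ _.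
move=> I1 I2; rewrite -(ler_pM2r h20) -{1}(gtr0_norm h20) -normrM.
have -> : (p - q) * h ^+ 2 = (a - c - b + f x - h ^+ 2 * q)
   - (a - b - c + f x - h ^+ 2 * p) by ring.
apply: le_trans (ler_normB _ _) _; apply: le_trans (lerD I2 I1) _.
by rewrite -mulrDl -splitr.
Qed.

End Schwarz.
End Calculus.

(** * Matrix-valued functions and 1-forms *)

Section MatrixCalculus.
Variable R : realType.
Notation V := 'rV[R]_6.

(** Taken entry by entry, which puts no constraint on the dimensions and reduces every rule to
    scalar functions. *)
Definition mdiff m n (M : V -> 'M[R]_(m, n)) (x : V) : Prop :=
  forall i j, differentiable (fun y => M y i j : R) x.

Definition dmx m n (u : V) (M : V -> 'M[R]_(m, n)) (x : V) : 'M[R]_(m, n) :=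
  \matrix_(i, j) 'D_u (fun y => M y i j : R) x.

Lemma differentiable_mdiff m n (f : V -> 'M[R]_(m.+1, n.+1)) x :
  differentiable f x -> mdiff f x.
Proof.
move=> df i j.
exact: (differentiable_comp df (differentiable_coord (f x) i j)).
Qed.

Lemma derive_dmx m n (f : V -> 'M[R]_(m.+1, n.+1)) u x :
  differentiable f x -> 'D_u f x = dmx u f x.
Proof. by move=> /diff_derivable df; rewrite derive_mx. Qed.

Lemma derive_comp (U W Z : normedModType R) (f : U -> W) (g : W -> Z) x u :
  differentiable f x -> differentiable g (f x) ->
  'D_u (g \o f) x = 'D_('D_u f x) g (f x).
Proof.
move=> df dg; rewrite (deriveE u (differentiable_comp df dg)).
by rewrite (deriveE _ dg) (deriveE u df) (diff_comp df dg).
Qed.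

Section Rules.
Variables (x u : V).

Lemma mdiff_cst m n (A : 'M[R]_(m, n)) : mdiff (fun=> A) x.
Proof. by move=> i j; exact: differentiable_cst. Qed.

Lemma dmx_cst m n (A : 'M[R]_(m, n)) : dmx u (fun=> A) x = 0.
Proof. by apply/matrixP => i j; rewrite !mxE derive_cst. Qed.

Lemma mdiffD m n (M N : V -> 'M[R]_(m, n)) :
  mdiff M x -> mdiff N x -> mdiff (fun y => M y + N y) x.
Proof.
move=> dM dN i j.
rewrite (_ : (fun y => _) = (fun y => M y i j : R) + (fun y => N y i j : R)).
  exact: differentiableD.
by apply/funext => y; rewrite mxE.
Qed.

Lemma dmxD m n (M N : V -> 'M[R]_(m, n)) : mdiff M x -> mdiff N x ->
  dmx u (fun y => M y + N y) x = dmx u M x + dmx u N x.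
Proof.
move=> dM dN; apply/matrixP => i j; rewrite !mxE.
rewrite (_ : (fun y => _) = (fun y => M y i j : R) + (fun y => N y i j : R)).
  by rewrite deriveD //; apply: diff_derivable; [exact: dM|exact: dN].
by apply/funext => y; rewrite mxE.
Qed.

(** Expanding on elementary matrices makes each entry of [L (M y)] a fixed linear combination of the
    entries of [M y]. *)
Lemma mdiff_lin m n p q (L : {linear 'M[R]_(m, n) -> 'M[R]_(p, q)}) M :
  mdiff M x -> mdiff (fun y => L (M y)) x.
Proof.
move=> dM i j.
rewrite (_ : (fun y => _) =
  \sum_a \sum_b (fun y => M y a b : R) * cst (L (delta_mx a b) i j)).
  apply: differentiable_sum => a; apply: differentiable_sum => b.
  by apply: differentiableM => //; exact: dM.
apply/funext => y; rewrite {1}(matrix_sum_delta (M y)) linear_sum summxE.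
rewrite fct_sumE; apply: eq_bigr => a _; rewrite linear_sum summxE fct_sumE.
by apply: eq_bigr => b _; rewrite linearZ mxE.
Qed.

Lemma dmx_lin m n p q (L : {linear 'M[R]_(m, n) -> 'M[R]_(p, q)}) M :
  mdiff M x -> dmx u (fun y => L (M y)) x = L (dmx u M x).
Proof.
move=> dM; apply/matrixP => i j; rewrite mxE.
rewrite (_ : (fun y => _) =
  \sum_a \sum_b (fun y => M y a b : R) * cst (L (delta_mx a b) i j)); last first.
  apply/funext => y; rewrite {1}(matrix_sum_delta (M y)) linear_sum summxE.
  rewrite fct_sumE; apply: eq_bigr => a _; rewrite linear_sum summxE fct_sumE.
  by apply: eq_bigr => b _; rewrite linearZ mxE.
have dab a b : derivable ((fun y => M y a b : R) * cst (L (delta_mx a b) i j)) x u.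
  by apply: derivableM => //; apply: diff_derivable; exact: dM.
rewrite derive_sum => [|a]; last by apply: derivable_sum => b.
rewrite {1}(matrix_sum_delta (dmx u M x)) linear_sum summxE.
apply: eq_bigr => a _; rewrite derive_sum // linear_sum summxE.
apply: eq_bigr => b _; rewrite linearZ mxE deriveM //; last first.
  by apply: diff_derivable; exact: dM.
by rewrite derive_cst scaler0 add0r mxE mulrC.
Qed.

Lemma mdiffN m n (M : V -> 'M[R]_(m, n)) : mdiff M x -> mdiff (fun y => - M y) x.
Proof. exact: (mdiff_lin (-%R : {linear 'M[R]_(m, n) -> 'M[R]_(m, n)})). Qed.

Lemma dmxN m n (M : V -> 'M[R]_(m, n)) :
  mdiff M x -> dmx u (fun y => - M y) x = - dmx u M x.
Proof. exact: (dmx_lin (-%R : {linear 'M[R]_(m, n) -> 'M[R]_(m, n)})). Qed.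

Lemma mdiffM m n p (M : V -> 'M[R]_(m, n)) (N : V -> 'M[R]_(n, p)) :
  mdiff M x -> mdiff N x -> mdiff (fun y => M y *m N y) x.
Proof.
move=> dM dN i j.
rewrite (_ : (fun y => _) = \sum_a (fun y => M y i a : R) * (fun y => N y a j : R)).
  apply: differentiable_sum => a.
  by apply: differentiableM; [exact: dM|exact: dN].
by apply/funext => y; rewrite mxE fct_sumE.
Qed.

Lemma dmxM m n p (M : V -> 'M[R]_(m, n)) (N : V -> 'M[R]_(n, p)) :
  mdiff M x -> mdiff N x ->
  dmx u (fun y => M y *m N y) x = dmx u M x *m N x + M x *m dmx u N x.
Proof.
move=> dM dN; apply/matrixP => i j; rewrite !mxE -big_split /=.
have dMa i' j' : derivable (fun y => M y i' j' : R) x u.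
  by apply: diff_derivable; exact: dM.
have dNa i' j' : derivable (fun y => N y i' j' : R) x u.
  by apply: diff_derivable; exact: dN.
rewrite (_ : (fun y => _) = \sum_a (fun y => M y i a : R) * (fun y => N y a j : R)).
  rewrite derive_sum; last by move=> a; apply: derivableM.
  apply: eq_bigr => a _; rewrite deriveM // addrC !mxE.
  by congr (_ + _); exact: mulrC.
by apply/funext => y; rewrite mxE fct_sumE.
Qed.

Lemma dmxMl m n p (A : 'M[R]_(m, n)) (M : V -> 'M[R]_(n, p)) :
  mdiff M x -> dmx u (fun y => A *m M y) x = A *m dmx u M x.
Proof. exact: (dmx_lin (mulmx A)). Qed.

Lemma mdiff_comp m n (f : V -> V) (M : V -> 'M[R]_(m, n)) :
  differentiable f x -> mdiff M (f x) -> mdiff (fun y => M (f y)) x.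
Proof.
move=> df dM i j.
exact: (differentiable_comp df (dM i j)).
Qed.

Lemma dmx_comp m n (f : V -> V) (M : V -> 'M[R]_(m, n)) :
  differentiable f x -> mdiff M (f x) ->
  dmx u (fun y => M (f y)) x = dmx ('D_u f x) M (f x).
Proof.
move=> df dM; apply/matrixP => i j; rewrite !mxE.
exact: (derive_comp u df (dM i j)).
Qed.

End Rules.

Lemma schwarz_mx m n (M : V -> 'M[R]_(m, n)) x u v : (forall y, mdiff M y) ->
  mdiff (dmx u M) x -> mdiff (dmx v M) x ->
  dmx v (dmx u M) x = dmx u (dmx v M) x.
Proof.
move=> dM du dv; apply/matrixP => i j; rewrite [LHS]mxE [RHS]mxE.
have E w : (fun y => dmx w M y i j) = 'D_w (fun y => M y i j : R).
  by apply/funext => y; rewrite mxE.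
have D w y : derivable (fun y => M y i j : R) y w.
  exact: diff_derivable (dM y i j).
move: (du i j) (dv i j); rewrite !E => dui dvi.
exact: (schwarz (D u) (D v) dui dvi).
Qed.

(** * Jacobian matrices *)

Section Jacobian.

Definition C2 (f : V -> V) : Prop :=
  (forall x, differentiable f x) /\ forall v x, differentiable ('D_v f) x.

Lemma smooth_C2 f : smooth f -> C2 f.
Proof.
move=> /(_ 2) [df d2f]; split => // v x; have [d2 _] := d2f v; exact: d2.
Qed.

(** The rows are the partial derivatives: the differential acts on row vectors from the right, and
    [jac_comp] multiplies in the order in which the maps are applied. *)
Definition jac (f : V -> V) (x : V) : 'M[R]_6 :=
  \matrix_(i, j) 'D_(delta_mx 0 i) f x 0 j.

Lemma mul_jac f x u : differentiable f x -> u *m jac f x = 'D_u f x.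
Proof.
move=> df; rewrite (deriveE u df) {2}(row_sum_delta u) linear_sum.
rewrite mulmx_sum_row; apply: eq_bigr => i _; rewrite linearZ; congr (_ *: _).
by apply/rowP => j; rewrite !mxE deriveE.
Qed.

Lemma mdiff_jac f x : C2 f -> mdiff (jac f) x.
Proof.
move=> [_ d2f] i j.
rewrite (_ : (fun y => _) = (fun y => 'D_(delta_mx 0 i) f y 0 j : R)).
  exact: differentiable_mdiff.
by apply/funext => y; rewrite mxE.
Qed.

(** [v *m dmx u (jac f) x] is the derivative along [u] of ['D_v f], so this is the symmetry of
    second derivatives. *)
Lemma dmx_jac_sym f x u v : C2 f ->
  v *m dmx u (jac f) x = u *m dmx v (jac f) x.
Proof.
move=> cf; have [df d2f] := cf.
have E w : (fun y => w *m jac f y) = dmx w f.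
  by apply/funext => y; rewrite mul_jac // derive_dmx.
rewrite -!dmxMl; try exact: mdiff_jac.
rewrite !E; apply: schwarz_mx => [y| |]; first exact: differentiable_mdiff.
  by rewrite -E => i j; apply: mdiffM; [exact: mdiff_cst|exact: mdiff_jac].
by rewrite -E => i j; apply: mdiffM; [exact: mdiff_cst|exact: mdiff_jac].
Qed.

Lemma jac_comp f g x : (forall y, differentiable f y) ->
  (forall y, differentiable g y) ->
  jac (g \o f) x = jac f x *m jac g (f x).
Proof.
move=> df dg; apply/row_matrixP => i; rewrite !rowE.
rewrite mulmxA (mul_jac _ (df x)) (mul_jac _ (dg (f x))).
rewrite (mul_jac _ (differentiable_comp (df x) (dg (f x)))).
exact: derive_comp.
Qed.

End Jacobian.

(** * Vector-valued 1-forms, their exterior derivative and pullback *)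

Section Forms.

(* A matrix-valued function T stands for the vector-valued 1-form
   u |-> u *m T x. *)
Definition dform (T : V -> 'M[R]_6) (x u v : V) : V :=
  v *m dmx u T x - u *m dmx v T x.

Definition pullback (f : V -> V) (T : V -> 'M[R]_6) (x : V) : 'M[R]_6 :=
  jac f x *m T (f x).

Lemma mdiff_pullback f T x : C2 f -> (forall y, mdiff T y) ->
  mdiff (pullback f T) x.
Proof.
move=> cf dT; apply: mdiffM; first exact: mdiff_jac.
by apply: mdiff_comp => //; exact: cf.1.
Qed.

(** Exterior differentiation commutes with pullback because the second derivatives of [f] cancel by
    symmetry. *)
Lemma dform_pullback f T x u v : C2 f -> (forall y, mdiff T y) ->
  dform (pullback f T) x u v = dform T (f x) (u *m jac f x) (v *m jac f x).
Proof.
move=> cf dT; have df := cf.1.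
have dTf : mdiff (fun y => T (f y)) x by exact: mdiff_comp.
have dJ := mdiff_jac x cf.
rewrite /dform /pullback !(dmxM _ dJ dTf) !(dmx_comp _ (df x) (dT (f x))).
rewrite !mulmxDr !mulmxA (dmx_jac_sym _ u v cf) !(mul_jac _ (df x)).
by rewrite opprD addrACA subrr add0r.
Qed.

End Forms.
End MatrixCalculus.

(** * Levi-Civita connection and curvature *)

Section LeftInvariant.
Variable R : realType.
Notation V := 'rV[R]_6.
Implicit Types (mu nu : V -> V -> V) (G P : 'M[R]_6) (x y z : V).

Definition bil mu : Prop :=
  (forall y, linear (mu^~ y)) /\ (forall x, linear (mu x)).

Lemma lie_bracket_bil mu : lie_bracket mu -> bil mu.
Proof. by case. Qed.

Lemma linear_formE (g : V -> R) x :
  (forall a y z, g (a *: y + z) = a * g y + g z) ->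
  g x = \sum_i x 0 i * g (delta_mx 0 i).
Proof.
move=> lg; pose gM := GRing.isLinear.Build _ _ _ _ (g : V -> R^o) lg.
pose gL : {linear V -> R^o} := HB.pack (g : V -> R^o) gM.
rewrite -[g]/(gL : _ -> _) {1}(row_sum_delta x) linear_sum.
by apply: eq_bigr => i _; rewrite linearZ.
Qed.

Lemma ipDl G a x y z : ip G (a *: x + y) z = a * ip G x z + ip G y z.
Proof. by rewrite /ip !mulmxDl -!scalemxAl !mxE. Qed.

Lemma ipDr G a x y z : ip G z (a *: x + y) = a * ip G z x + ip G z y.
Proof. by rewrite /ip !linearD !linearZ /= !mxE. Qed.

Lemma ip0E x y : ip ip0 x y = \sum_i x 0 i * y 0 i.
Proof.
by rewrite /ip /ip0 mulmx1 mxE; apply: eq_bigr => i _; rewrite mxE.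
Qed.

Lemma ipC G x y : G^T = G -> ip G x y = ip G y x.
Proof.
move=> GT; rewrite /ip -[in LHS](trmxK (x *m G *m y^T)) mxE.
by rewrite !trmx_mul trmxK GT mulmxA.
Qed.

Lemma ip_mul G P x y : ip G (x *m P) (y *m P) = ip (P *m G *m P^T) x y.
Proof. by rewrite /ip trmx_mul !mulmxA. Qed.

Lemma ip_inj G x y : G \in unitmx -> (forall z, ip G x z = ip G y z) -> x = y.
Proof.
move=> uG e; suff : x *m G = y *m G by move=> /(can_inj (mulmxK uG)).
apply/rowP => j; have := e (delta_mx 0 j).
by rewrite /ip trmx_delta -!colE !mxE.
Qed.

Section Nabla.
Variables (mu : V -> V -> V) (G : 'M[R]_6).
Hypothesis mub : bil mu.

Lemma nabla_bil : bil (nabla mu G).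
Proof.
have [ll lr] := mub.
have {}ll a x y z : mu (a *: x + y) z = a *: mu x z + mu y z by rewrite ll.
have {}lr a x y z : mu z (a *: x + y) = a *: mu z x + mu z y by rewrite lr.
split=> [z a x y|z a x y]; rewrite /nabla scalemxAl -mulmxDl; congr (_ *m _);
  apply/rowP => k; rewrite !mxE ?(ll, lr) ?(ipDl, ipDr); ring.
Qed.

(** [nabla] is defined by its pairings with the standard basis; both sides are linear in [z], so the
    formula extends to every vector. *)
Lemma koszul x y z : G \in unitmx -> ip G (nabla mu G x y) z =
  2^-1 * (ip G (mu x y) z - ip G (mu y z) x + ip G (mu z x) y).
Proof.
move=> uG; have [ll lr] := mub.
have {}ll a u v w : mu (a *: u + v) w = a *: mu u w + mu v w by rewrite ll.
have {}lr a u v w : mu w (a *: u + v) = a *: mu w u + mu w v by rewrite lr.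
pose g z := 2^-1 * (ip G (mu x y) z - ip G (mu y z) x + ip G (mu z x) y).
rewrite -[RHS]/(g z) (@linear_formE g); last first.
  by move=> a u v; rewrite /g ll lr !ipDl ipDr; ring.
rewrite /ip /nabla mulmxKV // mxE; apply: eq_bigr => i _.
by rewrite !mxE mulrC.
Qed.

Hypotheses (mu_alt : forall x, mu x x = 0) (GT : G^T = G) (uG : G \in unitmx).

Lemma mu_anti x y : mu y x = - mu x y.
Proof.
have [ll lr] := mub.
have := mu_alt (x + y).
have := ll (x + y) 1 x y; rewrite /= !scale1r => ->.
have := lr x 1 x y; rewrite /= !scale1r => ->.
have := lr y 1 x y; rewrite /= !scale1r => ->.
by rewrite !mu_alt add0r addr0 => /eqP; rewrite addrC addr_eq0 => /eqP.
Qed.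

Lemma ipN x y : ip G (- x) y = - ip G x y.
Proof. by rewrite /ip !mulNmx mxE. Qed.

Lemma nabla_torsion x y : nabla mu G x y - nabla mu G y x = mu x y.
Proof.
apply: (ip_inj uG) => z.
rewrite -[_ - _]addrC -scaleN1r ipDl !koszul //.
rewrite (mu_anti x y) (mu_anti z y) (mu_anti x z) !ipN; by field.
Qed.

Lemma nabla_metric x y z :
  ip G (nabla mu G x y) z + ip G y (nabla mu G x z) = 0.
Proof.
rewrite (ipC y _ GT) !koszul // (mu_anti y z) (mu_anti x y) (mu_anti z x) !ipN.
ring.
Qed.

End Nabla.

Lemma lin_comb3 (k : R) (a a' b b' c c' : V) :
  (k *: a + a') - (k *: b + b') - (k *: c + c') =
  k *: (a - b - c) + (a' - b' - c').
Proof. by apply/rowP => j; rewrite !mxE; ring. Qed.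

Lemma curvature_linl mu G y z : bil mu ->
  linear (fun x => curvature mu G x y z).
Proof.
move=> mub a u v; have [nl nr] := nabla_bil G mub; have [ll lr] := mub.
by rewrite /curvature nl ll nl nl nr lin_comb3.
Qed.

Lemma curvature_linm mu G x z : bil mu ->
  linear (fun y => curvature mu G x y z).
Proof.
move=> mub a u v; have [nl nr] := nabla_bil G mub; have [ll lr] := mub.
by rewrite /curvature nl lr nl nl nr lin_comb3.
Qed.

Lemma curvature_linr mu G x y : bil mu -> linear (curvature mu G x y).
Proof.
move=> mub a u v; have [nl nr] := nabla_bil G mub.
by rewrite /curvature !nr lin_comb3.
Qed.

Lemma ricci_tensorE mu G y z :
  ricci_tensor mu G y z = \sum_i curvature mu G (delta_mx 0 i) y z 0 i.
Proof. by apply: eq_bigr => i _; rewrite mxE. Qed.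

Definition ricci_mx mu G : 'M[R]_6 :=
  \matrix_(i, j) ricci_tensor mu G (delta_mx 0 i) (delta_mx 0 j).

Lemma ricci_mxE mu G y z : bil mu ->
  ricci_tensor mu G y z = (y *m ricci_mx mu G *m z^T) 0 0.
Proof.
move=> mub; rewrite (@linear_formE (ricci_tensor mu G ^~ z)); last first.
  move=> a u v; rewrite !ricci_tensorE mulr_sumr -big_split /=.
  by apply: eq_bigr => i _; rewrite curvature_linm // !mxE.
rewrite -mulmxA mxE; apply: eq_bigr => i _; congr (_ * _).
rewrite (@linear_formE (ricci_tensor mu G _)); last first.
  move=> a u v; rewrite !ricci_tensorE mulr_sumr -big_split /=.
  by apply: eq_bigr => k _; rewrite curvature_linr // !mxE.
by rewrite mxE; apply: eq_bigr => k _; rewrite !mxE mulrC.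
Qed.

Lemma RicE mu G : Ric mu G = ricci_mx mu G *m invmx G.
Proof. by []. Qed.

Lemma mulmx_delta m n (M : 'M[R]_(m, n)) i j :
  ((delta_mx 0 i : 'rV_m) *m M *m (delta_mx 0 j : 'rV_n)^T) 0 0 = M i j.
Proof. by rewrite trmx_delta -rowE -colE !mxE. Qed.

Section Conjugation.
Variables (mu nu : V -> V -> V) (G P : 'M[R]_6).
Hypotheses (mub : bil mu) (uP : P \in unitmx) (uG : G \in unitmx).

(** The Ricci tensor is a trace, hence insensitive to conjugation by [P]; raising an index with [G]
    and with its pullback turns this into conjugacy of the Ricci operators. *)
Lemma Ric_conj :
  (forall x y z, curvature mu G (x *m P) (y *m P) (z *m P) =
     curvature nu (P *m G *m P^T) x y z *m P) ->
  bil nu -> P *m Ric mu G = Ric nu (P *m G *m P^T) *m P.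
Proof.
move=> cE nub; set G' := P *m G *m P^T.
have rE y z : ricci_tensor mu G (y *m P) (z *m P) = ricci_tensor nu G' y z.
  rewrite /ricci_tensor.
  set M := lin1_mx _; set M' := lin1_mx _.
  suff E : P *m M = M' *m P.
    by rewrite -[M](mulKmx uP) E mulmxA mxtrace_mulC mulmxA mulmxV // mul1mx.
  apply/row_matrixP => i; rewrite !rowE !mulmxA.
  pose fM := GRing.isLinear.Build _ _ _ _
    (fun x => curvature mu G x (y *m P) (z *m P)) (curvature_linl _ _ _ mub).
  pose f : {linear V -> V} :=
    HB.pack (fun x => curvature mu G x (y *m P) (z *m P)) fM.
  rewrite -/(lin1_mx f) (mul_rV_lin1 f) /= cE; congr (_ *m P).
  by rewrite -rowE; apply/rowP => j; rewrite !mxE.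
have E : ricci_mx nu G' = P *m ricci_mx mu G *m P^T.
  apply/matrixP => i j; rewrite [LHS]mxE -rE ricci_mxE //.
  by rewrite trmx_mul -mulmx_delta !mulmxA.
have uPT : P^T \in unitmx by rewrite unitmx_tr.
rewrite !RicE E; apply: (can_inj (mulmxK uG)); rewrite -!mulmxA mulVmx // mulmx1.
congr (_ *m _); apply: (can_inj (mulmxK uPT)); rewrite -!mulmxA.
rewrite (mulmxA P G) -/G' mulVmx ?mulmx1 //.
by rewrite /G' !unitmx_mul uP uG.
Qed.

(** [P] is a morphism of brackets and an isometry from [P *m G *m P^T] to [G]. The Koszul formula
    determines the connection from these data, so [P] intertwines connections and then
    curvatures. *)
Lemma curvature_conj :
  G^T = G -> bil nu ->
  (forall x y, mu (x *m P) (y *m P) = nu x y *m P) ->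
  forall x y z, curvature mu G (x *m P) (y *m P) (z *m P) =
    curvature nu (P *m G *m P^T) x y z *m P.
Proof.
move=> GT nub mE; set G' := P *m G *m P^T.
have uG' : G' \in unitmx by rewrite /G' !unitmx_mul unitmx_tr uP uG.
have nE x y : nabla mu G (x *m P) (y *m P) = nabla nu G' x y *m P.
  apply: (ip_inj uG) => z; rewrite -(mulmxKV uP z); move: (z *m _) => {}z.
  by rewrite koszul // !mE !ip_mul koszul.
by move=> x y z; rewrite /curvature !nE mE nE !mulmxBl.
Qed.

End Conjugation.

(** The curvature endomorphism of the pair [a], [b]; the products are reversed because matrices act
    from the right. *)
Definition Kmx mu (a b : V) : 'M[R]_6 :=
  lin1_mx (nabla mu ip0 b) *m lin1_mx (nabla mu ip0 a)
  - lin1_mx (nabla mu ip0 a) *m lin1_mx (nabla mu ip0 b)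
  - lin1_mx (nabla mu ip0 (mu a b)).

Lemma mul_nabla_mx mu a c : bil mu ->
  c *m lin1_mx (nabla mu ip0 a) = nabla mu ip0 a c.
Proof.
move=> mub; have [_ nr] := nabla_bil ip0 mub.
pose fM := GRing.isLinear.Build _ _ _ _ (nabla mu ip0 a) (nr a).
pose f : {linear V -> V} := HB.pack (nabla mu ip0 a) fM.
exact: (mul_rV_lin1 f).
Qed.

Lemma mul_Kmx mu a b c : bil mu -> c *m Kmx mu a b = curvature mu ip0 a b c.
Proof.
by move=> mub; rewrite /Kmx !mulmxBr !mulmxA !mul_nabla_mx.
Qed.

Lemma nabla_mx_linear mu : bil mu -> linear (fun a => lin1_mx (nabla mu ip0 a)).
Proof.
move=> mub k a b; have [nl _] := nabla_bil ip0 mub.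
by apply/matrixP => i j; rewrite [LHS]mxE nl !mxE.
Qed.

End LeftInvariant.

(** * Maurer-Cartan forms *)

Section LieGroupForms.
Variable R : realType.
Notation V := 'rV[R]_6.
Variables (N : lie_group R).

Let mm (p : V * V) : V := lg_mul N p.1 p.2.

Lemma lg_mulVK x y : lg_mul N (lg_inv N x) (lg_mul N x y) = y.
Proof. by rewrite lg_mulA lg_mulV lg_mul1. Qed.

Lemma lg_mulKV x y : lg_mul N x (lg_mul N (lg_inv N x) y) = y.
Proof. by rewrite lg_mulA lg_Vmul lg_mul1. Qed.

(** The cancellation of [g] behind the left invariance of the Maurer-Cartan form. *)
Lemma lg_inv_mulVK g x y :
  lg_mul N (lg_inv N (lg_mul N g x)) (lg_mul N g y) = lg_mul N (lg_inv N x) y.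
Proof.
rewrite -{1}(lg_mulKV x y) (lg_mulA N g x).
exact: lg_mulVK.
Qed.

Lemma lg_inv1 : lg_inv N (lg_one N) = lg_one N.
Proof. by rewrite -[LHS](lg_1mul N) lg_mulV. Qed.

Lemma lg_diff p : differentiable mm p.
Proof. by have [dm _] := lg_smooth_mul N 1; exact: dm. Qed.

Lemma lg_diff2 w p : differentiable ('D_w mm) p.
Proof.
by have [_ dm] := lg_smooth_mul N 2; have [d2 _] := dm w; exact: d2.
Qed.

(** As a partial derivative of the jointly smooth product, the differential of a left translation
    depends differentiably on [g] as well as on [x]. *)
Lemma derive_ltr g x u : 'D_u (lg_mul N g) x = 'D_(0, u) mm (g, x).
Proof.
have E : (fun h : R => h^-1 *: (lg_mul N g (h *: u + x) - lg_mul N g x)) =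
         (fun h : R => h^-1 *: (mm (h *: (0, u) + (g, x)) - mm (g, x))).
  by apply/funext => h; rewrite /mm /= scaler0 add0r.
by rewrite /derive /= E.
Qed.

Lemma ltr_C2 g : C2 (lg_mul N g).
Proof.
have dp x : differentiable (fun y : V => (g, y)) x.
  by apply: differentiable_pair => //; exact: differentiable_cst.
split=> [x|v x].
  exact: (differentiable_comp (dp x) (lg_diff (g, x))).
rewrite (_ : 'D_v (lg_mul N g) = 'D_(0, v) mm \o (fun y => (g, y))).
  exact: (differentiable_comp (dp x) (lg_diff2 _ (g, x))).
by apply/funext => y; rewrite derive_ltr.
Qed.

Lemma lg_inv_diff x : differentiable (lg_inv N) x.
Proof. by have [di _] := lg_smooth_inv N 1; exact: di. Qed.

(** The left Maurer-Cartan form, which carries tangent vectors at [x] back to the identity. Its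
    inverse [lframe] is the frame of left invariant fields. *)
Definition mcform (x : V) : 'M[R]_6 := jac (lg_mul N (lg_inv N x)) x.
Definition lframe (x : V) : 'M[R]_6 := jac (lg_mul N x) (lg_one N).

Lemma mul_mcform x u : u *m mcform x = 'D_u (lg_mul N (lg_inv N x)) x.
Proof. by rewrite mul_jac //; exact: (ltr_C2 _).1. Qed.

Lemma mul_lframe x u : u *m lframe x = left_field N u x.
Proof. by rewrite mul_jac //; exact: (ltr_C2 _).1. Qed.

Lemma mdiff_mcform x : mdiff mcform x.
Proof.
move=> i j.
rewrite (_ : (fun y => _) =
  (fun y => ('D_(0, delta_mx 0 i) mm \o (fun y => (lg_inv N y, y))) y 0 j : R)).
  apply: differentiable_mdiff; apply: differentiable_comp.
    by apply: differentiable_pair => //; exact: lg_inv_diff.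
  exact: lg_diff2.
by apply/funext => y; rewrite mxE derive_ltr.
Qed.

Lemma differentiable_left_field u x : differentiable (left_field N u) x.
Proof.
rewrite (_ : left_field N u = 'D_(0, u) mm \o (fun y => (y, lg_one N))).
  apply: differentiable_comp; last exact: lg_diff2.
  by apply: differentiable_pair => //; exact: differentiable_cst.
by apply/funext => y; rewrite /left_field derive_ltr.
Qed.

Lemma mdiff_lframe x : mdiff lframe x.
Proof.
move=> i j.
rewrite (_ : (fun y => _) = (fun y => left_field N (delta_mx 0 i) y 0 j : R)).
  by apply: differentiable_mdiff; exact: differentiable_left_field.
by apply/funext => y; rewrite mxE.
Qed.

Lemma jac_id x : jac (id : V -> V) x = 1%:M.
Proof. by apply/matrixP => i j; rewrite mxE derive_id !mxE eqxx /= eq_sym. Qed.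

Lemma pullback_mcform g : pullback (lg_mul N g) mcform = mcform.
Proof.
apply/funext => x; rewrite /pullback /mcform.
rewrite -(jac_comp x (ltr_C2 g).1 (ltr_C2 (lg_inv N (lg_mul N g x))).1).
have -> : lg_mul N (lg_inv N (lg_mul N g x)) \o lg_mul N g =
    lg_mul N (lg_inv N x) by apply/funext => y; exact: lg_inv_mulVK.
by [].
Qed.

Lemma mcform1 : mcform (lg_one N) = 1%:M.
Proof.
have E : lg_mul N (lg_inv N (lg_one N)) = id.
  by apply/funext => y; rewrite lg_inv1 lg_mul1.
by rewrite /mcform E jac_id.
Qed.

(** Left invariance under translation by [x], read at the identity, where the form is the identity
    matrix. *)
Lemma lframe_mcform x : lframe x *m mcform x = 1%:M.
Proof.
have := congr1 (fun F => F (lg_one N)) (pullback_mcform x).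
by rewrite /= /pullback lg_1mul mcform1.
Qed.

Lemma mcform_lframe x : mcform x *m lframe x = 1%:M.
Proof. exact/mulmx1C/lframe_mcform. Qed.

Variable mu : V -> V -> V.
Hypothesis Nmu : has_lie_algebra N mu.

(** At the identity the equation is the definition of the Lie bracket by left invariant fields;
    pulling back along left translations carries it to every point. *)
Lemma maurer_cartan x u v :
  dform mcform x u v = - mu (u *m mcform x) (v *m mcform x).
Proof.
have at1 a b : dform mcform (lg_one N) a b = - mu a b.
  (* Differentiates [lframe y *m mcform y = 1%:M] at the identity, where both factors equal
     [1%:M]. *)
  have dE c : dmx c mcform (lg_one N) = - dmx c lframe (lg_one N).
    have dL := mdiff_lframe (lg_one N); have dT := mdiff_mcform (lg_one N).
    have := dmxM c dL dT.
    have -> : (fun y => lframe y *m mcform y) = fun=> 1%:M.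
      by apply/funext => y; exact: lframe_mcform.
    have lf1 : lframe (lg_one N) = 1%:M.
      by have := lframe_mcform (lg_one N); rewrite mcform1 mulmx1.
    rewrite dmx_cst mcform1 lf1 mulmx1 mul1mx => /eqP.
    by rewrite eq_sym addr_eq0 => /eqP ->; rewrite opprK.
  have lE c d : c *m dmx d lframe (lg_one N) = 'D_d (left_field N c) (lg_one N).
    rewrite derive_dmx; last exact: differentiable_left_field.
    rewrite -dmxMl; last exact: mdiff_lframe.
    have -> // : (fun y => c *m lframe y) = left_field N c.
    by apply/funext => y; rewrite mul_lframe.
  rewrite /dform !dE !mulmxN !lE opprK -Nmu /lg_bracket opprB addrC.
  by [].
have cL := ltr_C2 x.
have := @dform_pullback R (lg_mul N x) mcform (lg_one N) (u *m mcform x)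
  (v *m mcform x) cL mdiff_mcform.
rewrite pullback_mcform at1 lg_1mul -/(lframe x) -!mulmxA mcform_lframe.
by rewrite !mulmx1.
Qed.

End LieGroupForms.

(** * Curvature and isometries *)

Section Isometry.
Variable R : realType.
Notation V := 'rV[R]_6.

(** Six alternating swaps return [a b c] to its original order and collect three signs, so the value
    equals its opposite. *)
Lemma sym_skew_eq0 (U : Type) (s : U -> U -> U -> R) :
  (forall a b c, s a b c = s b a c) -> (forall a b c, s a b c = - s a c b) ->
  forall a b c, s a b c = 0.
Proof.
move=> sy sk a b c.
have := sy a b c; rewrite (sk b) (sy b) (sk c) (sy c) (sk a c); lra.
Qed.

Lemma form_mx_eq (M M' : 'M[R]_6) :
  (forall u v : V, (u *m M *m v^T) 0 0 = (u *m M' *m v^T) 0 0) -> M = M'.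
Proof. by move=> e; apply/matrixP => i j; rewrite -mulmx_delta e mulmx_delta. Qed.

Lemma skew_form (S : 'M[R]_6) (b c : V) : S + S^T = 0 ->
  (b *m S *m c^T) 0 0 = - (c *m S *m b^T) 0 0.
Proof.
move=> /addr0_eq e; transitivity ((b *m S *m c^T)^T 0 0); first by rewrite [RHS]mxE.
by rewrite !trmx_mul trmxK -e mulNmx mulmxN mxE mulmxA.
Qed.

Lemma nabla_mx_skew (mu : V -> V -> V) a : lie_bracket mu ->
  lin1_mx (nabla mu ip0 a) + (lin1_mx (nabla mu ip0 a))^T = 0.
Proof.
move=> mul; have mub := lie_bracket_bil mul; have [_ _ alt _] := mul.
apply: form_mx_eq => u v; rewrite mulmxDr mulmxDl mxE mulmx0 mul0mx [RHS]mxE.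
have := nabla_metric mub alt (trmx1 _ _) (unitmx1 _ _) a u v.
rewrite /ip /ip0 !mulmx1 -!mul_nabla_mx // trmx_mul mulmxA => <-.
by [].
Qed.

(** * Two Maurer-Cartan coframes related by an orthogonal matrix function *)

Section Frames.
Variables (mu nu : V -> V -> V).
Hypotheses (mul : lie_bracket mu) (nul : lie_bracket nu).
Variables (T E A : V -> 'M[R]_6).
Hypotheses (dT : forall x, mdiff T x) (dE : forall x, mdiff E x)
  (dA : forall x, mdiff A x).
Hypotheses (uT : forall x, T x \in unitmx) (EA : forall x, E x = T x *m A x)
  (AO : forall x, A x *m (A x)^T = 1%:M).
Hypothesis mcT :
  forall x u v, dform T x u v = - mu (u *m T x) (v *m T x).
Hypothesis mcE :
  forall x u v, dform E x u v = - nu (u *m E x) (v *m E x).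

Let mub := lie_bracket_bil mul.
Let nub := lie_bracket_bil nul.
Let C a := lin1_mx (nabla mu ip0 a).
Let D a := lin1_mx (nabla nu ip0 a).

Let OA x : (A x)^T *m A x = 1%:M.
Proof. exact/mulmx1C/AO. Qed.

Let dE_TA x u : dmx u E x = dmx u T x *m A x + T x *m dmx u A x.
Proof.
rewrite -(dmxM u (dT x) (dA x)).
by have -> : E = (fun y => T y *m A y) by apply/funext.
Qed.

(** Substituting [E = T A] in the structure equation of [E] and subtracting that of [T] leaves only
    derivatives of [A]. *)
Let torsion_A x u v :
  v *m T x *m dmx u A x - u *m T x *m dmx v A x =
  mu (u *m T x) (v *m T x) *m A x - nu (u *m E x) (v *m E x).
Proof.
have /(canRL opprK) -> : - mu (u *m T x) (v *m T x) = dform T x u v by rewrite mcT.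
have /(canRL opprK) -> : - nu (u *m E x) (v *m E x) = dform E x u v by rewrite mcE.
rewrite /dform !dE_TA !mulmxDr !mulmxA mulNmx mulmxBl.
move: (_ *m dmx u A x) (_ *m dmx v A x) => p q.
move: (_ *m _ *m A x) (_ *m _ *m A x) => r s.
by apply/rowP => k; rewrite !mxE; ring.
Qed.

Let skew_A x u : dmx u A x *m (A x)^T + A x *m (dmx u A x)^T = 0.
Proof.
have dAT : mdiff (fun y => (A y)^T) x by exact: (mdiff_lin trmx (dA x)).
have <- : dmx u (fun y => (A y)^T) x = (dmx u A x)^T.
  exact: (dmx_lin u trmx (dA x)).
rewrite -(dmxM u (dA x) dAT).
have -> : (fun y => A y *m (A y)^T) = fun=> 1%:M by apply/funext.
exact: dmx_cst.
Qed.

(** This is the uniqueness argument for the Levi-Civita connection. The defect [W] gives a trilinear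
    form [s], symmetric in its first two slots because both connections are torsion-free, and skew
    in its last two because both are metric and [A] is orthogonal. *)
Lemma gauge_derivative x u :
  dmx u A x = C (u *m T x) *m A x - A x *m D (u *m E x).
Proof.
pose W u := dmx u A x - (C (u *m T x) *m A x - A x *m D (u *m E x)).
suff W0 : W u = 0 by apply/eqP; rewrite -subr_eq0 -/(W u) W0.
have WE u' v : v *m T x *m W u' = v *m T x *m dmx u' A x
    - (nabla mu ip0 (u' *m T x) (v *m T x) *m A x
       - nabla nu ip0 (u' *m E x) (v *m E x)).
  rewrite /W !mulmxBr (mulmxA (v *m T x) (C _)) (mulmxA (v *m T x) (A x)).
  rewrite -(mulmxA v (T x) (A x)) -EA.
  by rewrite (mul_nabla_mx _ (v *m T x) mub) (mul_nabla_mx _ (v *m E x) nub).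
have Wsym u' v : v *m T x *m W u' = u' *m T x *m W v.
  have [_ _ mu_alt _] := mul; have [_ _ nu_alt _] := nul.
  have t1 := nabla_torsion mub mu_alt (unitmx1 _ _) (u' *m T x) (v *m T x).
  have t2 := nabla_torsion nub nu_alt (unitmx1 _ _) (u' *m E x) (v *m E x).
  have := torsion_A x u' v; rewrite -t1 -t2 mulmxBl !WE.
  move: (_ *m dmx u' A x) (_ *m dmx v A x) => p q.
  move: (_ *m A x) (_ *m A x) => r s.
  move: (nabla _ _ _ _) (nabla _ _ _ _) => r' s' /eqP.
  rewrite -subr_eq0 => /eqP e; apply/eqP; rewrite -subr_eq0 -e; apply/eqP.
  by apply/rowP => k; rewrite !mxE; ring.
have Wskew u' : W u' *m (A x)^T + (W u' *m (A x)^T)^T = 0.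
  pose Q := A x *m D (u' *m E x) *m (A x)^T.
  have WA : W u' *m (A x)^T = dmx u' A x *m (A x)^T - (C (u' *m T x) - Q).
    by rewrite /W !mulmxBl -(mulmxA (C _)) AO mulmx1.
  have eC : C (u' *m T x) + (C (u' *m T x))^T = 0 := nabla_mx_skew _ mul.
  have eQ : Q + Q^T = 0.
    rewrite /Q !trmx_mul trmxK mulmxA -mulmxDl -mulmxDr.
    by rewrite (nabla_mx_skew _ nul : D _ + (D _)^T = 0) mulmx0 mul0mx.
  have := skew_A x u'; rewrite -[A x *m (dmx u' A x)^T]trmxK trmx_mul trmxK.
  rewrite {}WA; move: (_ *m _) (C _) Q eC eQ => p c q eC eQ eP.
  have -> : (p - (c - q))^T = p^T - (c^T - q^T) by rewrite !raddfB.
  rewrite -(addr0_eq eP) -(addr0_eq eC) -(addr0_eq eQ).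
  by apply/matrixP => i j; rewrite !mxE; ring.
pose s (a b c : V) : R := ((b *m T x) *m W a *m (A x)^T *m (c *m T x)^T) 0 0.
have sy a b c : s a b c = s b a c by rewrite /s Wsym.
have sk a b c : s a b c = - s a c b.
  by rewrite /s -!(mulmxA _ (W _)) (skew_form _ _ (Wskew a)).
have s0 := sym_skew_eq0 sy sk.
have WT0 : T x *m (W u *m (A x)^T) *m (T x)^T = 0.
  apply: form_mx_eq => b c; have := s0 u b c.
  by rewrite /s trmx_mul !mulmxA mulmx0 mul0mx => ->; rewrite mxE.
have : T x *m W u *m (A x)^T = 0.
  apply: (can_inj (mulmxK (_ : (T x)^T \in unitmx))); first by rewrite unitmx_tr.
  by rewrite mul0mx -WT0 !mulmxA.
move=> /(congr1 (mulmx^~ (A x))); rewrite /= -mulmxA OA mulmx1 mul0mx => TW.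
by rewrite -[LHS](mulKmx (uT x)) TW mulmx0.
Qed.

Lemma Kmx_intertwine x u v :
  Kmx mu (u *m T x) (v *m T x) *m A x = A x *m Kmx nu (u *m E x) (v *m E x).
Proof.
pose cM := GRing.isLinear.Build _ _ _ _ C (nabla_mx_linear mub).
pose CL : {linear V -> 'M[R]_6} := HB.pack C cM.
pose dM := GRing.isLinear.Build _ _ _ _ D (nabla_mx_linear nub).
pose DL : {linear V -> 'M[R]_6} := HB.pack D dM.
have lc (u' : V) : mdiff (fun y => u' *m T y) x by apply: mdiffM => //; exact: mdiff_cst.
have le (u' : V) : mdiff (fun y => u' *m E y) x by apply: mdiffM => //; exact: mdiff_cst.
have mc u' : mdiff (fun y => CL (u' *m T y)) x by exact: mdiff_lin.
have me u' : mdiff (fun y => DL (u' *m E y)) x by exact: mdiff_lin.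
have dAE u' : dmx u' A = fun y => CL (u' *m T y) *m A y + - (A y *m DL (u' *m E y)).
  by apply/funext => y; rewrite gauge_derivative.
have m1 u' : mdiff (fun y => CL (u' *m T y) *m A y) x by exact: mdiffM.
have m2 u' : mdiff (fun y => A y *m DL (u' *m E y)) x by exact: mdiffM.
have m2N u' : mdiff (fun y => - (A y *m DL (u' *m E y))) x by exact: mdiffN.
have ddA u' v' : dmx v' (dmx u' A) x =
    (CL (u' *m dmx v' T x) *m A x + CL (u' *m T x) *m dmx v' A x)
    - (dmx v' A x *m DL (u' *m E x) + A x *m DL (u' *m dmx v' E x)).
  rewrite dAE (dmxD v' (m1 u') (m2N u')) (dmxN v' (m2 u')).
  rewrite (dmxM v' (mc u') (dA x)) (dmxM v' (dA x) (me u')).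
  rewrite (dmx_lin v' CL (lc u')) (dmx_lin v' DL (le u')).
  by rewrite (dmxMl v' u' (dT x)) (dmxMl v' u' (dE x)).
have dd u' : mdiff (dmx u' A) x by rewrite dAE; exact: mdiffD.
have := schwarz_mx dA (dd u) (dd v); rewrite !ddA.
(* Exchanging [u] and [v] in the derivative of [T] costs a bracket, by the structure equation; it
   supplies the third term of the curvature. *)
have eT : CL (u *m dmx v T x) = CL (v *m dmx u T x) + CL (mu (u *m T x) (v *m T x)).
  rewrite -linearD; congr (CL _).
  have /(canRL opprK) -> : - mu (u *m T x) (v *m T x) = dform T x u v by rewrite mcT.
  by rewrite /dform opprB addrC subrK.
have eE : DL (u *m dmx v E x) = DL (v *m dmx u E x) + DL (nu (u *m E x) (v *m E x)).
  rewrite -linearD; congr (DL _).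
  have /(canRL opprK) -> : - nu (u *m E x) (v *m E x) = dform E x u v by rewrite mcE.
  by rewrite /dform opprB addrC subrK.
rewrite {}eT {}eE !gauge_derivative.
have eC b : CL b = C b by [].
have eD b : DL b = D b by [].
rewrite !eC !eD.
have KC a b : Kmx mu a b = C b *m C a - C a *m C b - C (mu a b) by [].
have KD a b : Kmx nu a b = D b *m D a - D a *m D b - D (nu a b) by [].
rewrite {}KC {}KD.
move: (C (u *m T x)) (C (v *m T x)) (C (mu _ _)) (C (v *m dmx u T x)) => a b k p.
move: (D (u *m E x)) (D (v *m E x)) (D (nu _ _)) (D (v *m dmx u E x)) => a' b' k' p'.
move: (A x) => M.
rewrite !(mulmxDl, mulmxDr, mulNmx, mulmxN) !mulmxA.
move: (p *m M) (k *m M) (a *m b *m M) (a *m M *m b') (b *m M *m a').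
move: (M *m b' *m a') (M *m p') (M *m k') (b *m a *m M) (M *m a' *m b').
move=> t1 t2 t3 t4 t5 t6 t7 t8 t9 t10 /eqP.
rewrite -subr_eq0 => /eqP e; apply/eqP; rewrite -subr_eq0 -oppr_eq0 -e; apply/eqP.
by apply/matrixP => i j; rewrite !mxE; ring.
Qed.

End Frames.

Theorem isometric_curvature mu nu : lie_bracket mu -> lie_bracket nu ->
  isometric mu ip0 nu ip0 ->
  exists2 A : 'M[R]_6, A *m A^T = 1%:M &
    forall x y z, curvature nu ip0 (x *m A) (y *m A) (z *m A) =
                  curvature mu ip0 x y z *m A.
Proof.
move=> mul nul [N [N' [Nmu N'nu [f [sf _ fiso]]]]].
have cf := smooth_C2 sf.
pose E := pullback f (mcform N').
pose A x := lframe N x *m E x.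
have dT := @mdiff_mcform R N.
have dT' := @mdiff_mcform R N'.
have dE x : mdiff E x := mdiff_pullback x cf dT'.
have dA x : mdiff A x := mdiffM (mdiff_lframe N x) (dE x).
have uT x : mcform N x \in unitmx := (mulmx1_unit (mcform_lframe N x)).1.
have EA x : E x = mcform N x *m A x.
  by rewrite /A mulmxA mcform_lframe mul1mx.
(* The isometry condition says that [E x] and [mcform N x] induce the same inner product on the
   tangent space at [x]. *)
have AO x : A x *m (A x)^T = 1%:M.
  have e : E x *m (E x)^T = mcform N x *m (mcform N x)^T.
    apply: form_mx_eq => u v; move: (fiso x u v).
    rewrite /left_metric -!mul_mcform -!(mul_jac _ (cf.1 x)).
    rewrite -!(mulmxA _ (jac f x)) -/(pullback f _ x) !ip_mul /ip /ip0 !mulmx1.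
    by [].
  rewrite /A trmx_mul mulmxA -(mulmxA (lframe N x)) e !mulmxA lframe_mcform mul1mx.
  by rewrite -trmx_mul lframe_mcform trmx1.
have mcE x u v : dform E x u v = - nu (u *m E x) (v *m E x).
  rewrite (dform_pullback x u v cf dT') (maurer_cartan N'nu).
  by rewrite -(mulmxA u) -(mulmxA v).
exists (A (lg_one N)); first exact: AO.
move=> x y z.
have := Kmx_intertwine mul nul dT dE dA uT EA AO (maurer_cartan Nmu) mcE
  (lg_one N) x y.
rewrite mcform1 !mulmx1 EA mcform1 mul1mx; move: (A _) => M h.
rewrite -(mul_Kmx x y z (lie_bracket_bil mul)).
by rewrite -(mul_Kmx (x *m M) (y *m M) (z *m M) (lie_bracket_bil nul)) -!mulmxA h.
Qed.

End Isometry.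

(** * Ricci curvature of nilpotent brackets *)

(** The characteristic polynomial divides the determinant of [X^k - M^k = X^k], which is a power of
    [X]. Being monic it is a power of [X] itself, and its subleading coefficient, minus the trace,
    is zero. *)
Lemma mxtrace_nilpotent (F : fieldType) n (M : 'M[F]_n.+1) k :
  M ^+ k = 0 -> \tr M = 0.
Proof.
move=> Mk.
have : char_poly M %| 'X^(k * n.+1).
  have c : GRing.comm ('X%:M : 'M[{poly F}]_n.+1) (map_mx polyC M).
    exact: comm_scalar_mx.
  have := subrXX_comm k c.
  have -> : map_mx polyC M ^+ k = 0 by rewrite -rmorphXn /= Mk map_mx0.
  have -> : 'X%:M ^+ k = ('X^k)%:M :> 'M[{poly F}]_n.+1 by rewrite -rmorphXn.
  rewrite subr0 -/(char_poly_mx M) => /(congr1 determinant).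
  rewrite det_scalar -exprM det_mulmx -/(char_poly M) => ->.
  exact: dvdp_mulr.
rewrite -['X]subr0 -polyC0 => /dvdp_exp_XsubCP [j _].
rewrite polyC0 subr0 eqp_monic ?char_poly_monic ?monicXn // => /eqP cE.
have := size_char_poly M; rewrite cE size_polyXn => -[jE].
have := char_poly_trace M (ltn0Sn n); rewrite cE jE coefXn /= ltn_eqF //.
by move/eqP; rewrite eq_sym oppr_eq0 => /eqP.
Qed.

Lemma mxtraceN (S : pzRingType) n (A : 'M[S]_n) : \tr (- A) = - \tr A.
Proof. exact: raddfN. Qed.

Lemma mxtraceB (S : pzRingType) n (A B : 'M[S]_n) : \tr (A - B) = \tr A - \tr B.
Proof. exact: raddfB. Qed.

Section Ricci.
Variable R : realType.
Notation V := 'rV[R]_6.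
Implicit Types (mu : V -> V -> V) (x y z : V).

Definition admx mu x : 'M[R]_6 := lin1_mx (mu x).

Lemma mul_admx mu x y : bil mu -> y *m admx mu x = mu x y.
Proof.
move=> [_ lr]; pose fM := GRing.isLinear.Build _ _ _ _ (mu x) (lr x).
pose f : {linear V -> V} := HB.pack (mu x) fM.
exact: (mul_rV_lin1 f).
Qed.

Lemma foldr_nilpotent mu k (s : seq V) y :
  (forall (s : seq V) y, size s = k -> foldr mu y s = 0) ->
  (k <= size s)%N -> foldr mu y s = 0.
Proof.
move=> nk ks; rewrite -(cat_take_drop k s) foldr_cat nk //.
by rewrite size_takel.
Qed.

Lemma nilpotent_trace mu x : bil mu -> nilpotent mu -> \tr (admx mu x) = 0.
Proof.
move=> mub [k nk]; apply: (@mxtrace_nilpotent _ _ _ k).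
apply/row_matrixP => i; rewrite row0 rowE.
suff -> j y : y *m admx mu x ^+ j = foldr mu y (nseq j x).
  by rewrite nk // size_nseq.
elim: j => [|j IH]; first by rewrite expr0 mulmx1.
by rewrite exprSr mulmxA IH mul_admx.
Qed.

(** The Killing form vanishes: the [j]-th power of the product acts by iterated brackets of length
    [2 j], so the [k]-th power is zero. *)
Lemma nilpotent_killing mu x z : bil mu -> nilpotent mu ->
  \tr (admx mu x *m admx mu z) = 0.
Proof.
move=> mub [k nk]; apply: (@mxtrace_nilpotent _ _ _ k).
apply/row_matrixP => i; rewrite row0 rowE.
suff -> j y : y *m (admx mu x *m admx mu z) ^+ j
              = foldr mu y (flatten (nseq j [:: z; x])).
  apply: (foldr_nilpotent _ nk); rewrite size_flatten /shape map_nseq.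
  by rewrite sumn_nseq /= mulnC leq_pmulr.
elim: j => [|j IH]; first by rewrite expr0 mulmx1.
by rewrite exprSr mulmxA IH mulmxA !mul_admx.
Qed.

Lemma trace_sym_skew (S T : 'M[R]_6) : S^T = S -> T^T = - T -> \tr (S *m T) = 0.
Proof.
move=> eS eT; have : \tr (S *m T) = - \tr (S *m T).
  by rewrite -[LHS]mxtrace_tr trmx_mul eS eT mulNmx mxtraceN mxtrace_mulC.
by move/eqP; rewrite -addr_eq0 -mulr2n mulrn_eq0 /= => /eqP.
Qed.

Lemma trace_sym_skew_mul (M N S T : 'M[R]_6) :
  M^T = M -> N^T = N -> S^T = - S -> T^T = - T ->
  \tr ((M + S) *m (N + T)) = \tr (M *m N) - \tr (S *m T^T).
Proof.
move=> eM eN eS eT; rewrite mulmxDl !mulmxDr !mxtraceD eT mulmxN mxtraceN opprK.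
by rewrite (trace_sym_skew eM eT) (mxtrace_mulC S N) (trace_sym_skew eN eS) addr0 add0r.
Qed.

Lemma trace_symmetrized (A B : 'M[R]_6) :
  \tr ((A + A^T) *m (B + B^T)) = 2 * \tr (A *m B) + 2 * \tr (A *m B^T).
Proof.
have e : \tr (A^T *m B) = \tr (A *m B^T).
  by rewrite -mxtrace_tr trmx_mul trmxK mxtrace_mulC.
rewrite mulmxDl !mulmxDr !mxtraceD -trmx_mul mxtrace_tr (mxtrace_mulC B) e; ring.
Qed.

(** Up to sign, the exterior derivative of the left invariant 1-form dual to [y]. *)
Definition formmx mu y : 'M[R]_6 :=
  \matrix_(i, j) ip ip0 (mu (delta_mx 0 i) (delta_mx 0 j)) y.

Lemma ip_delta (x : V) j : ip ip0 x (delta_mx 0 j) = x 0 j.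
Proof. by rewrite /ip /ip0 mulmx1 trmx_delta -colE mxE. Qed.

Section Unimodular.
Variable mu : V -> V -> V.
Hypotheses (mul : lie_bracket mu) (trad : forall x, \tr (admx mu x) = 0).
Let mub := lie_bracket_bil mul.
Let alt : forall x, mu x x = 0. Proof. by case: mul. Qed.

Let B y : 'M[R]_6 := lin1_mx (nabla mu ip0 ^~ y).

Let mulB x y : x *m B y = nabla mu ip0 x y.
Proof.
have [nl _] := nabla_bil ip0 mub.
pose fM := GRing.isLinear.Build _ _ _ _ (nabla mu ip0 ^~ y) (nl y).
pose f : {linear V -> V} := HB.pack (nabla mu ip0 ^~ y) fM.
exact: (mul_rV_lin1 f).
Qed.

(** The Koszul formula splits the endomorphism [x |-> nabla x y] into a symmetric part from [admx]
    and a skew part from [formmx]. *)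
Let BE y : B y = 2^-1 *: - (admx mu y + (admx mu y)^T + formmx mu y).
Proof.
apply/matrixP => i j; have := koszul mub (delta_mx 0 i) y (delta_mx 0 j) (unitmx1 _ _).
rewrite ip_delta -mulB -rowE mxE => ->.
rewrite (mu_anti mub alt y (delta_mx 0 i)) (mu_anti mub alt (delta_mx 0 i) (delta_mx 0 j)).
by rewrite !ipN !ip_delta !mxE; ring.
Qed.

(** Torsion-freeness rewrites the derivative along [mu x y] through [B]; under the trace, the terms
    containing the connection along [y] cancel by cyclicity. *)
Lemma ricci_unimodular y z :
  ricci_tensor mu ip0 y z = - \tr (B y *m B z).
Proof.
have cE : lin1_mx (fun x => curvature mu ip0 x y z) =
    B (nabla mu ip0 y z) - B z *m lin1_mx (nabla mu ip0 y)
    - (B y - lin1_mx (nabla mu ip0 y)) *m B z.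
  apply/row_matrixP => i; rewrite !rowE; set e := delta_mx 0 i.
  rewrite 2!mulmxBr !(mulmxA e) mulmxBr (mulB e y) (mulB e z).
  rewrite (mulB e (nabla mu ip0 y z)) (mul_nabla_mx y _ mub) (mul_nabla_mx y e mub).
  rewrite (nabla_torsion mub alt (unitmx1 _ _)) (mulB (mu e y) z) /e.
  by rewrite -rowE; apply/rowP => j; rewrite !mxE.
rewrite /ricci_tensor cE mulmxBl !mxtraceB (mxtrace_mulC (lin1_mx _)).
(* Unimodularity kills the trace of the symmetric part of [B], and the skew part has zero
   diagonal. *)
have -> : \tr (B (nabla mu ip0 y z)) = 0.
  rewrite BE mxtraceZ mxtraceN !mxtraceD mxtrace_tr trad !add0r.
  suff -> : \tr (formmx mu (nabla mu ip0 y z)) = 0 by rewrite oppr0 mulr0.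
  by apply: big1 => i _; rewrite mxE alt /ip !mul0mx mxE.
rewrite sub0r; ring.
Qed.

Hypothesis killing : forall x y, \tr (admx mu x *m admx mu y) = 0.

Lemma ricci_nilpotent_tr y z : ricci_tensor mu ip0 y z =
  - 2^-1 * \tr (admx mu y *m (admx mu z)^T)
  + 4^-1 * \tr (formmx mu y *m (formmx mu z)^T).
Proof.
have skew w : (formmx mu w)^T = - formmx mu w.
  by apply/matrixP => i j; rewrite !mxE (mu_anti mub alt) ipN.
have sym w : (admx mu w + (admx mu w)^T)^T = admx mu w + (admx mu w)^T.
  by rewrite raddfD /= trmxK addrC.
rewrite ricci_unimodular !BE -scalemxAl -scalemxAr scalerA mulmxN mulNmx opprK.
rewrite mxtraceZ (trace_sym_skew_mul (sym y) (sym z) (skew y) (skew z)).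
by rewrite trace_symmetrized killing; field.
Qed.

End Unimodular.

Lemma trace_mulmx_tr (A B : 'M[R]_6) :
  \tr (A *m B^T) = \sum_i \sum_j A i j * B i j.
Proof. by apply: eq_bigr => i _; rewrite mxE; apply: eq_bigr => j _; rewrite mxE. Qed.

Definition sc mu (i j k : 'I_6) : R := mu (delta_mx 0 i) (delta_mx 0 j) 0 k.

Lemma Ric_nilpotent mu i j : lie_bracket mu -> nilpotent mu ->
  Ric mu ip0 i j = - 2^-1 * (\sum_k \sum_l sc mu i k l * sc mu j k l)
    + 4^-1 * (\sum_k \sum_l sc mu k l i * sc mu k l j).
Proof.
move=> mul nmu; have mub := lie_bracket_bil mul.
rewrite RicE invmx1 mulmx1 mxE ricci_nilpotent_tr //.
- rewrite !trace_mulmx_tr; congr (_ * _ + _ * _); apply: eq_bigr => k _;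
    apply: eq_bigr => l _; by rewrite !mxE ?ip_delta.
- by move=> x; exact: nilpotent_trace.
- by move=> x y; exact: nilpotent_killing.
Qed.

Lemma normsqE mu : normsq mu = \sum_i \sum_j \sum_k sc mu i j k * sc mu i j k.
Proof. by apply: eq_bigr => i _; apply: eq_bigr => j _; rewrite ip0E. Qed.

Lemma normsq_exchange mu :
  normsq mu = \sum_k \sum_i \sum_j sc mu i j k * sc mu i j k.
Proof.
rewrite normsqE [RHS]exchange_big; apply: eq_bigr => i _.
by rewrite [RHS]exchange_big.
Qed.

Lemma scal_nilpotent mu : lie_bracket mu -> nilpotent mu ->
  scal mu ip0 = - 4^-1 * normsq mu.
Proof.
move=> mul nmu; pose n1 i := \sum_k \sum_l sc mu i k l * sc mu i k l.
pose n2 i := \sum_k \sum_l sc mu k l i * sc mu k l i.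
transitivity (\sum_i (- 2^-1 * n1 i + 4^-1 * n2 i)).
  by apply: eq_bigr => i _; rewrite Ric_nilpotent.
rewrite big_split /= -!mulr_sumr -normsqE -normsq_exchange; by field.
Qed.

End Ricci.

(** * The family mu_abc *)

Section FamilyTheory.
Variable R : realType.
Notation V := 'rV[R]_6.
Implicit Types (a b c : R) (x y z : V).

(** Presents an index as [inord k], so that matrix identities reduce to case analysis on a natural
    number. *)
Lemma ord6_ind (P : 'I_6 -> Prop) :
  (forall k (lk : (k < 6)%N), P (inord k)) -> forall i, P i.
Proof. by move=> h i; rewrite -(inord_val i); apply: h. Qed.

Lemma inord_eq m n : (m < 6)%N -> (n < 6)%N ->
  (inord m == inord n :> 'I_6) = (m == n).
Proof. by move=> lm ln; rewrite -val_eqE /= !inordK. Qed.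

Lemma alphaX i j : (0 < i <= 6)%N -> (0 < j <= 6)%N ->
  alpha i (X j) = (i == j)%:R :> R.
Proof.
case: i => // i; case: j => // j /= li lj.
by rewrite /alpha /X mxE eqxx /= inord_eq.
Qed.

Lemma alpha_inj x y :
  (forall i, (0 < i <= 6)%N -> alpha i x = alpha i y) -> x = y.
Proof.
move=> h; apply/rowP => j; have := h j.+1.
by rewrite /alpha /= inord_val; apply; rewrite ltn_ord.
Qed.

Lemma alphaP i k x y : alpha i (k *: x + y) = k * alpha i x + alpha i y.
Proof. by rewrite /alpha !mxE. Qed.

Lemma alphaD i x y : alpha i (x + y) = alpha i x + alpha i y.
Proof. by rewrite /alpha mxE. Qed.

Lemma alphaZ i k x : alpha i (k *: x) = k * alpha i x.
Proof. by rewrite /alpha mxE. Qed.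

Lemma alpha0 i : alpha i (0 : V) = 0.
Proof. by rewrite /alpha mxE. Qed.

Lemma alpha_mu a b c x y i : (0 < i <= 6)%N ->
  alpha i (mu_abc a b c x y) =
  a * wedge (alpha 1) (alpha 2) x y * (i == 4)%:R
  + b * wedge (alpha 1) (alpha 3) x y * (i == 5)%:R
  + c * wedge (alpha 2) (alpha 3) x y * (i == 6)%:R.
Proof. by move=> li; rewrite !alphaD !alphaZ !alphaX. Qed.

Lemma mu_abc_two_step a b c x y z : mu_abc a b c x (mu_abc a b c y z) = 0.
Proof.
by apply: alpha_inj => i li; rewrite alpha_mu // /wedge !alpha_mu //= alpha0; ring.
Qed.

Lemma mu_abc_lie a b c : lie_bracket (mu_abc a b c).
Proof.
split=> [y k x z|x k y z|x|x y z]; last by rewrite !mu_abc_two_step !addr0.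
- by apply: alpha_inj => i li; rewrite alphaP !alpha_mu // /wedge !alphaP; ring.
- by apply: alpha_inj => i li; rewrite alphaP !alpha_mu // /wedge !alphaP; ring.
- by apply: alpha_inj => i li; rewrite alpha_mu // /wedge alpha0; ring.
Qed.

Lemma mu_abc_nilpotent a b c : nilpotent (mu_abc a b c).
Proof. by exists 2 => -[|x [|y [|]]] // z _; exact: mu_abc_two_step. Qed.

Lemma closed_mu_abc a b c : closed_form omega (mu_abc a b c) <-> a - b + c = 0.
Proof.
(* On these three vectors the cyclic sum is [- (a - b + c)]. *)
split=> [/(_ (X 1) (X 2) (X 3))|abc x y z].
  by rewrite /omega /wedge !alpha_mu // /wedge !alphaX //=; lra.
rewrite /omega /wedge !alpha_mu // /wedge /=.
have -> : c = b - a by lra.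
ring.
Qed.

Lemma omega_delta i j : (i < 6)%N -> (j < 6)%N ->
  form_mx (@omega R) (inord i) (inord j) =
  if (i + j == 5)%N then (if (i < 3)%N then 1 else -1) else 0.
Proof.
move=> li lj; rewrite mxE.
have -> : delta_mx 0 (inord i) = X i.+1 :> V by [].
have -> : delta_mx 0 (inord j) = X j.+1 :> V by [].
rewrite /omega /wedge !alphaX //.
by case: i li => [|[|[|[|[|[|]]]]]] //; case: j lj => [|[|[|[|[|[|]]]]]] //= _ _; ring.
Qed.

Definition sc_abc a b c (i j k : nat) : R :=
  match i, j, k with
  | 0, 1, 3 => a | 1, 0, 3 => - a
  | 0, 2, 4 => b | 2, 0, 4 => - b
  | 1, 2, 5 => c | 2, 1, 5 => - c
  | _, _, _ => 0
  end.

Lemma sc_mu_abc a b c i j k : (i < 6)%N -> (j < 6)%N -> (k < 6)%N ->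
  sc (mu_abc a b c) (inord i) (inord j) (inord k) = sc_abc a b c i j k.
Proof.
move=> li lj lk.
have -> : sc (mu_abc a b c) (inord i) (inord j) (inord k) =
          alpha k.+1 (mu_abc a b c (X i.+1) (X j.+1)) by [].
rewrite alpha_mu // /wedge !alphaX // !eqSS.
by move: i j k {li lj lk} => [|[|[|i]]] [|[|[|j]]] [|[|[|[|[|[|k]]]]]] /=; ring.
Qed.

Lemma sum6 (f : 'I_6 -> R) : \sum_i f i =
  f (inord 0) + f (inord 1) + f (inord 2) + f (inord 3) + f (inord 4) + f (inord 5).
Proof.
rewrite 6!big_ord_recl big_ord0 addr0 !addrA.
by congr (_ + _ + _ + _ + _ + _); congr f; apply/val_inj; rewrite /= inordK.
Qed.

Lemma diag6E (s : seq R) i j : (i < 6)%N -> (j < 6)%N ->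
  diag6 s (inord i) (inord j) = s`_i *+ (i == j).
Proof. by move=> li lj; rewrite !mxE inordK // inord_eq. Qed.

Lemma Ric_mu_abc a b c : Ric (mu_abc a b c) ip0 =
  2^-1 *: diag6 [:: - (a ^+ 2 + b ^+ 2); - (a ^+ 2 + c ^+ 2); - (b ^+ 2 + c ^+ 2);
                a ^+ 2; b ^+ 2; c ^+ 2].
Proof.
apply/matrixP => i j; move: i j.
apply: ord6_ind => i li; apply: ord6_ind => j lj.
rewrite (Ric_nilpotent _ _ (mu_abc_lie a b c) (mu_abc_nilpotent a b c)).
rewrite [RHS]mxE diag6E // !sum6 !sc_mu_abc //.
by case: i li => [|[|[|[|[|[|]]]]]] //= _;
   case: j lj => [|[|[|[|[|[|]]]]]] //= _; field.
Qed.

End FamilyTheory.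


(** * Ricci operators, center and isometry invariants of the family *)

Section FamilyResults.
Variable R : realType.
Notation V := 'rV[R]_6.
Implicit Types (a b c s t : R) (x y z : V).

Lemma Jmx_ip0 (om : V -> V -> R) : Jmx om ip0 = (form_mx om)^T.
Proof. by rewrite /Jmx invmx1 mul1mx. Qed.

Lemma Jmx_omega i j : (i < 6)%N -> (j < 6)%N ->
  Jmx (@omega R) ip0 (inord i) (inord j) =
  if (i + j == 5)%N then (if (j < 3)%N then 1 else -1) else 0.
Proof. by move=> li lj; rewrite Jmx_ip0 mxE omega_delta // addnC. Qed.

Lemma inner_product_ip0 : inner_product (@ip0 R).
Proof.
split; first exact: trmx1.
move=> x x0; rewrite ip0E lt_def sumr_ge0; last by move=> i _; rewrite -expr2 sqr_ge0.
rewrite andbT; apply: contraNneq x0 => /eqP.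
rewrite psumr_eq0 => [/allP h|i _]; last by rewrite -expr2 sqr_ge0.
apply/eqP/rowP => i; rewrite mxE; apply/eqP.
by have := h i (mem_index_enum i); rewrite /= -expr2 sqrf_eq0.
Qed.

Lemma compatible_omega_ip0 : compatible (@omega R) ip0.
Proof.
split; first exact: inner_product_ip0.
apply/matrixP => i j; move: i j.
apply: ord6_ind => i li; apply: ord6_ind => j lj.
rewrite [LHS]mxE sum6 !Jmx_omega // !mxE inord_eq //.
by case: i li => [|[|[|[|[|[|]]]]]] //= _;
   case: j lj => [|[|[|[|[|[|]]]]]] //= _; ring.
Qed.

(** [J] exchanges [X i] and [X (7 - i)] up to sign, so the [i]-th eigenvalue is half the difference
    of the Ricci eigenvalues at [i] and [7 - i]. *)
Lemma Ric_ac_mu_abc a b c : Ric_ac omega (mu_abc a b c) ip0 =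
  - (1 / 4 * (a ^+ 2 + b ^+ 2 + c ^+ 2)) *: diag6 [:: 1; 1; 1; -1; -1; -1].
Proof.
apply/matrixP => i j; move: i j.
apply: ord6_ind => i li; apply: ord6_ind => j lj.
rewrite /Ric_ac Ric_mu_abc [RHS]mxE diag6E // [LHS]mxE [X in 2^-1 * X]mxE.
rewrite [X in _ + X]mxE sum6 -scalemxAr.
have jd k l (q : seq R) : (k < 6)%N -> (l < 6)%N ->
    (Jmx omega ip0 *m diag6 q) (inord k) (inord l) =
    Jmx omega ip0 (inord k) (inord l) * q`_l :> R.
  by move=> lk ll; rewrite /diag6 mul_mx_diag !mxE inordK.
rewrite ![(2^-1 *: (Jmx _ _ *m _)) _ _]mxE ![(2^-1 *: diag6 _) _ _]mxE !jd //.
rewrite !Jmx_omega // diag6E //.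
by case: i li => [|[|[|[|[|[|]]]]]] //= _;
   case: j lj => [|[|[|[|[|[|]]]]]] //= _; field.
Qed.

Lemma diag6_split (S : R) :
  - (1 / 4 * S) *: diag6 [:: 1; 1; 1; -1; -1; -1]
  = - (3 / 4 * S) *: 1%:M + (1 / 2 * S) *: diag6 [:: 1; 1; 1; 2; 2; 2].
Proof.
apply/matrixP => i j; move: i j.
apply: ord6_ind => i li; apply: ord6_ind => j lj.
rewrite [LHS]mxE [RHS]mxE [X in _ = X + _]mxE [X in _ = _ + X]mxE !diag6E //.
rewrite mxE inord_eq //.
by case: i li => [|[|[|[|[|[|]]]]]] //= _;
   case: j lj => [|[|[|[|[|[|]]]]]] //= _; field.
Qed.

(** The diagonal matrix is the grading: generators have weight 1 and their brackets weight 2. *)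
Lemma derivation_mu_abc a b c k :
  derivation (mu_abc a b c) (k *: diag6 [:: 1; 1; 1; 2; 2; 2]).
Proof.
have aD i x : (0 < i <= 6)%N -> alpha i (x *m (k *: diag6 [:: 1; 1; 1; 2; 2; 2]))
    = alpha i x * k * [:: 1; 1; 1; 2; 2; 2]`_i.-1 :> R.
  case: i => // i li; rewrite /alpha -scalemxAr /diag6 mul_mx_diag !mxE inordK //.
  by rewrite mulrCA mulrA.
move=> x y; apply: alpha_inj => i li.
rewrite aD // alphaD !alpha_mu // /wedge !aD //=.
by case: i li => [|[|[|[|[|[|[|]]]]]]] //= _; ring.
Qed.

Lemma scal_mu_abc a b c :
  scal (mu_abc a b c) ip0 = - 2^-1 * (a ^+ 2 + b ^+ 2 + c ^+ 2).
Proof.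
rewrite /scal Ric_mu_abc mxtraceZ /diag6 mxtrace_diag sum6 !mxE !inordK //=.
by field.
Qed.

Lemma mul_X_Ric a b c i : (0 < i <= 6)%N ->
  X i *m Ric (mu_abc a b c) ip0 =
  (2^-1 * [:: - (a ^+ 2 + b ^+ 2); - (a ^+ 2 + c ^+ 2); - (b ^+ 2 + c ^+ 2);
              a ^+ 2; b ^+ 2; c ^+ 2]`_i.-1) *: X i.
Proof.
move=> li; apply: alpha_inj => j lj.
rewrite Ric_mu_abc alphaZ alphaX // /alpha -scalemxAr /diag6 mul_mx_diag !mxE eqxx /=.
case: i li => // i; case: j lj => // j /= lj li.
rewrite inordK // inord_eq // eqSS eq_sym.
by case: eqP => [->|_]; rewrite ?mulr1 ?mul1r ?mulr0 ?mul0r ?mulr0.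
Qed.

(** By [a - b + c = 0], two vanishing coefficients would force the third to vanish, against the
    normalization. Each of the first three coordinates of a central vector is annihilated by two
    coefficients, hence is zero. *)
Lemma center_mu_abc a b c : a ^+ 2 + b ^+ 2 + c ^+ 2 = 2 -> a - b + c = 0 ->
  lie_center (mu_abc a b c)
  = [set x | exists p q r : R, x = p *: X 4 + q *: X 5 + r *: X 6].
Proof.
move=> S2 abc; apply/seteqP; split => [x /= h|x /= [p [q [r ->]]] y]; last first.
  apply: alpha_inj => i li; rewrite alpha_mu // /wedge !alphaD !alphaZ !alphaX //.
  by rewrite alpha0 /=; ring.
have e (j i : nat) : (0 < j <= 6)%N -> (0 < i <= 6)%N ->
    alpha i (mu_abc a b c x (X j)) = 0 by move=> lj li; rewrite h alpha0.
have := e 1%N 4%N isT isT; have := e 1%N 5%N isT isT.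
have := e 2%N 4%N isT isT; have := e 2%N 6%N isT isT.
have := e 3%N 5%N isT isT; have := e 3%N 6%N isT isT.
rewrite !alpha_mu // /wedge !alphaX //=.
move=> c2 b1 c3 a1 b3 a2.
have x1 : alpha 1 x = 0.
  apply/eqP; apply: contraT => x1.
  have a0 : a = 0 by apply: (mulIf x1); rewrite mul0r; lra.
  have b0 : b = 0 by apply: (mulIf x1); rewrite mul0r; lra.
  have c0 : c = 0 by lra.
  by move: S2; rewrite a0 b0 c0; lra.
have x2 : alpha 2 x = 0.
  apply/eqP; apply: contraT => x2.
  have a0 : a = 0 by apply: (mulIf x2); rewrite mul0r; lra.
  have c0 : c = 0 by apply: (mulIf x2); rewrite mul0r; lra.
  have b0 : b = 0 by lra.
  by move: S2; rewrite a0 b0 c0; lra.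
have x3 : alpha 3 x = 0.
  apply/eqP; apply: contraT => x3.
  have b0 : b = 0 by apply: (mulIf x3); rewrite mul0r; lra.
  have c0 : c = 0 by apply: (mulIf x3); rewrite mul0r; lra.
  have a0 : a = 0 by lra.
  by move: S2; rewrite a0 b0 c0; lra.
exists (alpha 4 x), (alpha 5 x), (alpha 6 x); apply: alpha_inj => i li.
rewrite !alphaD !alphaZ !alphaX //.
by case: i li => [|[|[|[|[|[|[|]]]]]]] //= _; rewrite ?x1 ?x2 ?x3; ring.
Qed.

Lemma on_curveP s t : on_curve s t ->
  [/\ s * (s + t) = 1 - t ^+ 2, 0 <= t & 3 * t ^+ 2 <= 1].
Proof.
move=> [e /andP[t0 t3]]; split=> //; first by rewrite -e; ring.
have q3 : 0 < Num.sqrt (3 : R) by rewrite sqrtr_gt0.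
have : t * Num.sqrt 3 <= 1 by rewrite -ler_pdivlMr // mul1r.
have := sqr_sqrtr (ler0n R 3).
have := mulr_ge0 t0 (ltW q3).
set q := t * _ => q0 e3 q1.
have : q ^+ 2 <= 1 by rewrite expr_le1.
by rewrite exprMn e3 mulrC.
Qed.

Lemma on_curve_normsq s t : on_curve s t -> s ^+ 2 + (s + t) ^+ 2 + t ^+ 2 = 2.
Proof.
case=> e _; have : 2 * (s ^+ 2 + s * t + t ^+ 2) = 2 by rewrite e; ring.
by move=> <-; ring.
Qed.

(** On the curve the product is [(1 - t ^+ 2) * t], which is nonnegative and injective for
    [3 * t ^+ 2 <= 1]. *)
Lemma on_curve_inj s t s' t' : on_curve s t -> on_curve s' t' ->
  (s * (s + t) * t) ^+ 2 = (s' * (s' + t') * t') ^+ 2 -> t = t'.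
Proof.
move=> /on_curveP [-> t0 t3] /on_curveP [-> t0' t3'] e.
have pos (u : R) : 0 <= u -> 3 * u ^+ 2 <= 1 -> 0 <= (1 - u ^+ 2) * u.
  by move=> u0 u3; apply: mulr_ge0 => //; have := sqr_ge0 u; lra.
have /eqP : (1 - t ^+ 2) * t = (1 - t' ^+ 2) * t'.
  by apply/eqP; rewrite -(eqrXn2 (ltn0Sn 1)) ?pos //; apply/eqP.
rewrite -subr_eq0.
have -> : (1 - t ^+ 2) * t - (1 - t' ^+ 2) * t' =
  (t - t') * (1 - t ^+ 2 - t * t' - t' ^+ 2) by ring.
rewrite mulf_eq0 subr_eq0 => /orP[/eqP //|/eqP e0].
(* Now [t ^+ 2 + t * t' + t' ^+ 2 = 1], so [(t - t') ^+ 2 = 3 * t ^+ 2 + 3 * t' ^+ 2 - 2], which is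
   at most 0. *)
apply/eqP; rewrite -subr_eq0 -sqrf_eq0 eq_le sqr_ge0 andbT.
have -> : (t - t') ^+ 2 = t ^+ 2 + t' ^+ 2 - 2 * (t * t') by ring.
lra.
Qed.

Lemma trace_cube_conj (A M M' : 'M[R]_6) : A \in unitmx -> A *m M' = M *m A ->
  \tr (M' *m M' *m M') = \tr (M *m M *m M).
Proof.
move=> uA e; have -> : M' = invmx A *m (M *m A) by rewrite -e mulKmx.
rewrite -!mulmxA mulKVmx // mulKVmx // mxtrace_mulC -!mulmxA.
by rewrite mulmxV // mulmx1.
Qed.

Lemma isometric_Ric (mu nu : V -> V -> V) : lie_bracket mu -> lie_bracket nu ->
  isometric mu ip0 nu ip0 ->
  exists2 A : 'M[R]_6, A \in unitmx & A *m Ric nu ip0 = Ric mu ip0 *m A.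
Proof.
move=> mul nul /(isometric_curvature mul nul) [A AO cE].
have uA : A \in unitmx := (mulmx1_unit AO).1.
exists A => //.
have e1 : A *m ip0 *m A^T = ip0 by rewrite mulmx1.
have := Ric_conj (lie_bracket_bil nul) uA (unitmx1 _ _).
by rewrite e1 => /(_ _ cE (lie_bracket_bil mul)).
Qed.

Definition ric_cubes a b c : R :=
  8^-1 * (a ^+ 6 + b ^+ 6 + c ^+ 6
    - (a ^+ 2 + b ^+ 2) ^+ 3 - (a ^+ 2 + c ^+ 2) ^+ 3 - (b ^+ 2 + c ^+ 2) ^+ 3).

Lemma trace_Ric_cube a b c : \tr (Ric (mu_abc a b c) ip0 *m Ric (mu_abc a b c) ip0
  *m Ric (mu_abc a b c) ip0) = ric_cubes a b c.
Proof.
rewrite Ric_mu_abc -!(scalemxAl, scalemxAr) !scalerA mxtraceZ /diag6.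
by rewrite !mulmx_diag mxtrace_diag sum6 !mxE !inordK //= /ric_cubes; field.
Qed.

Lemma isometric_mu_abc a b c a' b' c' :
  isometric (mu_abc a b c) ip0 (mu_abc a' b' c') ip0 ->
  ric_cubes a b c = ric_cubes a' b' c'.
Proof.
move=> /(isometric_Ric (mu_abc_lie a b c) (mu_abc_lie a' b' c')) [A uA e].
rewrite -(trace_Ric_cube a b c) -(trace_Ric_cube a' b' c').
exact: (esym (trace_cube_conj uA e)).
Qed.

Lemma ric_cubes_curve s t : on_curve s t ->
  ric_cubes s (s + t) t = -1 + 3 / 4 * (s * (s + t) * t) ^+ 2.
Proof.
(* Homogenizing [-1] as minus the cube of [s ^+ 2 + s * t + t ^+ 2] makes this a polynomial identity
   of degree 6. *)
move=> [e _]; transitivity (- (s ^+ 2 + s * t + t ^+ 2) ^+ 3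
    + 3 / 4 * (s * (s + t) * t) ^+ 2); first by rewrite /ric_cubes; field.
by rewrite e expr1n.
Qed.

Lemma not_isometric_mu_st s t s' t' : on_curve s t -> on_curve s' t' ->
  t <> t' -> ~ isometric (mu_st s t) ip0 (mu_st s' t') ip0.
Proof.
move=> cst cst' tt' /isometric_mu_abc; rewrite !ric_cubes_curve // => e.
apply: tt'; apply: (on_curve_inj cst cst'); lra.
Qed.

End FamilyResults.

(** * Symplectic and Lie algebra isomorphisms *)

Section SymplecticInvariant.
Variable R : realType.
Notation V := 'rV[R]_6.
Implicit Types (a b c s t : R) (x y z : V).

Lemma sum3 (f : 'I_3 -> R) : \sum_i f i = f (inord 0) + f (inord 1) + f (inord 2).
Proof.
rewrite 3!big_ord_recl big_ord0 addr0 !addrA.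
by congr (_ + _ + _); congr f; apply/val_inj; rewrite /= inordK.
Qed.

Lemma ord3_ind (P : 'I_3 -> Prop) :
  (forall k (lk : (k < 3)%N), P (inord k)) -> forall i, P i.
Proof. by move=> h i; rewrite -(inord_val i); apply: h. Qed.

Definition mx3 (p : nat -> nat -> R) : 'M[R]_3 := \matrix_(i, j) p i j.

Lemma mx3E p i j : (i < 3)%N -> (j < 3)%N -> mx3 p (inord i) (inord j) = p i j.
Proof. by move=> li lj; rewrite mxE !inordK. Qed.

(* The closed brackets mu_abc correspond to the traceless diagonal matrices
   diag (c, -b, a): omega (mu x y) z = - (x cross y) diag (c, -b, a) z^T on the
   span of X_1, X_2, X_3. *)
Definition inv_mx a b c : 'M[R]_3 :=
  mx3 (fun i j => [:: c; - b; a]`_i *+ (i == j)).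

(** Cyclic successor of an index; with it the minors in [cof3] carry their cofactor signs
    automatically. *)
Definition rot3 (i : nat) : nat := nth 0%N [:: 1; 2; 0]%N i.

Definition cof3 (p : nat -> nat -> R) : 'M[R]_3 := mx3 (fun i j =>
  p (rot3 i) (rot3 j) * p (rot3 (rot3 i)) (rot3 (rot3 j))
  - p (rot3 i) (rot3 (rot3 j)) * p (rot3 (rot3 i)) (rot3 j)).

Lemma tr_mul_cof3 p : exists l, (mx3 p)^T *m cof3 p = l%:M.
Proof.
pose q i := p 0%N i; pose r i := p 1%N i; pose u i := p 2%N i.
(* The determinant of [mx3 p], expanded along the first column. *)
exists (q 0%N * (r 1%N * u 2%N - r 2%N * u 1%N)
  + r 0%N * (u 1%N * q 2%N - u 2%N * q 1%N)
  + u 0%N * (q 1%N * r 2%N - q 2%N * r 1%N)).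
apply/matrixP => i j; move: i j.
apply: ord3_ind => i li; apply: ord3_ind => j lj.
rewrite !mxE sum3 ![(_^T) _ _]mxE !mx3E // -val_eqE /= !inordK // /q /r /u.
by case: i li => [|[|[|]]] //= _; case: j lj => [|[|[|]]] //= _; ring.
Qed.

(** An isomorphism preserves the trilinear form [omega (mu x y) z]. The pair [x], [y] enters through
    a cross product, which transforms by cofactors, and [z] enters linearly, which gives the
    transpose. *)
Lemma symplectic_isomorphic_cof3 a b c a' b' c' :
  symplectic_isomorphic (mu_abc a b c) omega (mu_abc a' b' c') omega ->
  exists p, inv_mx a b c = cof3 p *m inv_mx a' b' c' *m (mx3 p)^T.
Proof.
move=> [phi _ [mE oE]].
pose p i j := phi (inord i) (inord j).
have aE i j : (0 < i <= 6)%N -> (0 < j <= 6)%N ->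
    alpha j (X i *m phi) = p i.-1 j.-1.
  by move=> _ _; rewrite /alpha /X -rowE mxE.
have e i j k : (0 < i <= 6)%N -> (0 < j <= 6)%N -> (0 < k <= 6)%N ->
    omega (mu_abc a b c (X i) (X j)) (X k) =
    omega (mu_abc a' b' c' (X i *m phi) (X j *m phi)) (X k *m phi).
  by move=> li lj lk; rewrite -mE oE.
exists p; apply/matrixP => i j; move: i j.
apply: ord3_ind => i li; apply: ord3_ind => j lj.
rewrite [RHS]mxE sum3 ![(_ *m _) _ _]mxE !sum3 ![(_^T) _ _]mxE !mx3E //.
have lj' : (0 < j.+1 <= 6)%N by apply: leq_trans lj _.
(* Row [i] comes from the pair of basis vectors complementary to the [i]-th one. *)
case: i li => [|[|[|]]] //= _.
- have := e 2 3 j.+1 isT isT lj'.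
  rewrite /omega /wedge !alpha_mu // /wedge !alphaX // !aE //=.
  by case: j lj {lj'} => [|[|[|]]] //= _; lra.
- have := e 1 3 j.+1 isT isT lj'.
  rewrite /omega /wedge !alpha_mu // /wedge !alphaX // !aE //=.
  by case: j lj {lj'} => [|[|[|]]] //= _; lra.
- have := e 1 2 j.+1 isT isT lj'.
  rewrite /omega /wedge !alpha_mu // /wedge !alphaX // !aE //=.
  by case: j lj {lj'} => [|[|[|]]] //= _; lra.
Qed.

(** Inside a power of [M], each adjacent [P^T *m C] collapses to [l]; cyclicity of the trace closes
    the product and yields the last factor [l]. *)
Lemma twisted_conj_traces (P C M M' : 'M[R]_3) l : P^T *m C = l%:M ->
  M^T = M -> M = C *m M' *m P^T ->
  \tr (M *m M) = l ^+ 2 * \tr (M' *m M') /\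
  \tr (M *m M *m M) = l ^+ 3 * \tr (M' *m M' *m M').
Proof.
move=> PC MT ME.
have PM : P^T *m M = l *: (M' *m P^T).
  by rewrite ME !mulmxA PC mul_scalar_mx -scalemxAl.
have MM : M *m M = l *: (C *m M' *m M' *m P^T).
  by rewrite {1}ME -mulmxA PM -scalemxAr !mulmxA.
have MMM : M *m M *m M = l ^+ 2 *: (C *m M' *m M' *m M' *m P^T).
  by rewrite MM -scalemxAl -mulmxA PM -scalemxAr scalerA expr2 !mulmxA.
split.
  rewrite MM mxtraceZ mxtrace_mulC !mulmxA PC mul_scalar_mx -!scalemxAl mxtraceZ.
  by rewrite mulrA expr2.
rewrite MMM mxtraceZ mxtrace_mulC !mulmxA PC mul_scalar_mx -!scalemxAl mxtraceZ.
by rewrite mulrA -exprSr.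
Qed.

Lemma inv_mx_traces a b c :
  \tr (inv_mx a b c *m inv_mx a b c) = a ^+ 2 + b ^+ 2 + c ^+ 2 /\
  \tr (inv_mx a b c *m inv_mx a b c *m inv_mx a b c) = a ^+ 3 - b ^+ 3 + c ^+ 3.
Proof.
have E : inv_mx a b c = diag_mx (\row_(j < 3) [:: c; - b; a]`_j).
  by apply/matrixP => i j; rewrite !mxE val_eqE; case: eqP => [->|].
by rewrite E !mulmx_diag !mxtrace_diag !sum3 !mxE !inordK //=; split; ring.
Qed.

Lemma not_symplectic_isomorphic_mu_st s t s' t' : on_curve s t -> on_curve s' t' ->
  t <> t' -> ~ symplectic_isomorphic (mu_st s t) omega (mu_st s' t') omega.
Proof.
move=> cst cst' tt' /symplectic_isomorphic_cof3 [p e].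
have [l le] := tr_mul_cof3 p.
have sym : (inv_mx s (s + t) t)^T = inv_mx s (s + t) t.
  by apply/matrixP => i j; rewrite !mxE !val_eqE eq_sym; case: eqP => [->|].
have [] := twisted_conj_traces le sym e.
have [-> ->] := inv_mx_traces s (s + t) t.
have [-> ->] := inv_mx_traces s' (s' + t') t'.
rewrite !on_curve_normsq // => l2 l3; apply: tt'; apply: (on_curve_inj cst cst').
have cube a b : a ^+ 3 - (a + b) ^+ 3 + b ^+ 3 = - 3 * (a * (a + b) * b) by ring.
move: l3; rewrite !cube => l3.
(* Both squared norms are 2, so [l ^+ 2 = 1]; then [l ^+ 6 = 1] and the squared products agree. *)
have {}l2 : l ^+ 2 = 1 by lra.
have {}l3 : s * (s + t) * t = l ^+ 3 * (s' * (s' + t') * t') by lra.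
by rewrite l3 exprMn -exprM mulnC exprM l2 expr1n mul1r.
Qed.

End SymplecticInvariant.

(** * Structure equations of the underlying Lie algebras *)

Section IsomorphismType.
Variable R : realType.
Notation V := 'rV[R]_6.
Implicit Types (a b c s t : R) (x y z : V).

Lemma lie_isomorphic_refl (mu : V -> V -> V) : lie_isomorphic mu mu.
Proof. by exists 1%:M; [exact: unitmx1|move=> x y; rewrite !mulmx1]. Qed.

Lemma covecE (E : 'M[R]_6) i x : (0 < i <= 6)%N ->
  covec E i x = alpha 1 x * E (inord 0) (inord i.-1) + alpha 2 x * E (inord 1) (inord i.-1)
    + alpha 3 x * E (inord 2) (inord i.-1) + alpha 4 x * E (inord 3) (inord i.-1)
    + alpha 5 x * E (inord 4) (inord i.-1) + alpha 6 x * E (inord 5) (inord i.-1).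
Proof. by move=> li; rewrite /covec /alpha mxE sum6. Qed.

(** The coframe [alpha 1], [alpha 2], [alpha 3], [alpha 6], [- alpha 4], [- alpha 5]; the signs
    offset the one in [d1]. *)
Definition coframe10 : 'M[R]_6 := \matrix_(i, j)
  match nat_of_ord i, nat_of_ord j with
  | 0%N, 0%N | 1%N, 1%N | 2%N, 2%N | 5%N, 3%N => 1
  | 3%N, 4%N | 4%N, 5%N => -1
  | _, _ => 0
  end.

Lemma coframe10_unit : coframe10 \in unitmx.
Proof.
apply: (fun e => (@mulmx1_unit _ _ _ coframe10^T e).1).
apply/matrixP => i j; move: i j.
apply: ord6_ind => i li; apply: ord6_ind => j lj.
rewrite mxE sum6 ![(_^T) _ _]mxE !mxE !inordK // inord_eq //.
by case: i li => [|[|[|[|[|[|]]]]]] //= _;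
   case: j lj => [|[|[|[|[|[|]]]]]] //= _; ring.
Qed.

Lemma mu_10_structure :
  exists (nu : V -> V -> V) (E : 'M[R]_6),
     let e := covec E in
     [/\ lie_bracket nu, E \in unitmx,
         [/\ d1 nu (e 1%N) = (fun _ _ => 0), d1 nu (e 2%N) = (fun _ _ => 0),
             d1 nu (e 3%N) = (fun _ _ => 0), d1 nu (e 4%N) = (fun _ _ => 0) &
             d1 nu (e 5%N) = wedge (e 1%N) (e 2%N) /\
             d1 nu (e 6%N) = wedge (e 1%N) (e 3%N)] &
         lie_isomorphic (mu_st 1 0) nu].
Proof.
exists (mu_st 1 0), coframe10 => e; split.
- exact: mu_abc_lie.
- exact: coframe10_unit.
- split; last split; apply/funext => x; apply/funext => y;
    rewrite /d1 /e /wedge !covecE // /mu_st !alpha_mu // !mxE !inordK //= /wedge;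
    ring.
- exact: lie_isomorphic_refl.
Qed.

Lemma mu_st_structure s t : on_curve s t -> 0 < t ->
     exists (nu : V -> V -> V) (E : 'M[R]_6),
       let e := covec E in
       [/\ lie_bracket nu, E \in unitmx,
           [/\ d1 nu (e 1%N) = (fun _ _ => 0), d1 nu (e 2%N) = (fun _ _ => 0) &
               d1 nu (e 3%N) = (fun _ _ => 0)],
           [/\ d1 nu (e 4%N) = wedge (e 1%N) (e 2%N), d1 nu (e 5%N) = wedge (e 1%N) (e 3%N) &
               d1 nu (e 6%N) = wedge (e 2%N) (e 3%N)] &
           lie_isomorphic (mu_st s t) nu].
Proof.
move=> /on_curveP [sst t0 t3] tpos.
(* The product is [1 - t ^+ 2] with [t ^+ 2] at most 1/3; hence all three coefficients are nonzero
   and the last three covectors can be rescaled. *)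
have : s * (s + t) != 0 by rewrite sst; apply/eqP => h; lra.
rewrite mulf_eq0 negb_or => /andP[s0 st0]; have tn0 : t != 0 by rewrite gt_eqF.
exists (mu_st s t), (diag6 [:: 1; 1; 1; - s^-1; - (s + t)^-1; - t^-1]) => e; split.
- exact: mu_abc_lie.
- apply: (fun e => (@mulmx1_unit _ _ _ (diag6 [:: 1; 1; 1; - s; - (s + t); - t]) e).1).
  rewrite /diag6 mulmx_diag; apply/matrixP => i j; move: i j.
  apply: ord6_ind => i li; apply: ord6_ind => j lj.
  rewrite !mxE !inordK // inord_eq //.
  case: i li => [|[|[|[|[|[|]]]]]] //= _; rewrite ?mulr1 ?mulrNN ?mulVf //.
- split; apply/funext => x; apply/funext => y;
    rewrite /d1 /e !covecE // /mu_st !alpha_mu // !diag6E //= /wedge; ring.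
- split; apply/funext => x; apply/funext => y;
    rewrite /d1 /e /wedge !covecE // /mu_st !alpha_mu // !diag6E //= /wedge;
    by field; rewrite ?s0 ?st0 ?tn0.
- exact: lie_isomorphic_refl.
Qed.

End IsomorphismType.

(** * Minimal metrics *)

Section Orthonormalization.
Variable R : realType.

Definition posdef n (G : 'M[R]_n) : Prop :=
  G^T = G /\ forall x : 'rV_n, x != 0 -> 0 < (x *m G *m x^T) 0 0.

(** Gram-Schmidt run from the last basis vector: row [i] of [P] lies in the span of the basis
    vectors from [i] on, so the span of the last three is preserved. *)
Definition upper_orthonormal n (G P : 'M[R]_n) : Prop :=
  P *m G *m P^T = 1%:M /\ forall i j : 'I_n, (j < i)%N -> P i j = 0.

Lemma upper_orthonormal_step n (G : 'M[R]_(1 + n)) : posdef G ->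
  (forall G1 : 'M[R]_n, posdef G1 -> exists P1, upper_orthonormal G1 P1) ->
  exists P, upper_orthonormal G P.
Proof.
move=> [GT Gpos] IH; pose G1 := drsubmx G; pose g := ulsubmx G.
pose r := ursubmx G.
have GE : G = block_mx g r r^T G1 by rewrite -[LHS]submxK trmx_ursub GT.
have G1T : G1^T = G1 by rewrite trmx_drsub GT.
have val (u : 'rV_1) (v : 'rV_n) : row_mx u v *m G *m (row_mx u v)^T =
    (u *m g + v *m r^T) *m u^T + (u *m r + v *m G1) *m v^T.
  by rewrite GE tr_row_mx mul_row_block mul_row_col.
have [|P1 [P1E P1T]] := IH G1.
  split=> // x x0; have := Gpos (row_mx 0 x).
  by rewrite row_mx_eq0 negb_and x0 orbT val !mul0mx trmx0 mulmx0 !add0r; apply.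
have uG1 : G1 \in unitmx.
  by have := unitmx1 R n; rewrite -P1E !unitmx_mul => /andP[/andP[_ ->]].
(* The row [(1, w)] is orthogonal to all later basis vectors; [s] is its squared length and [p]
   normalizes it. *)
pose w : 'rV_n := - r *m invmx G1.
have wr : r + w *m G1 = 0 by rewrite /w mulmxKV // subrr.
pose s := (g + w *m r^T) 0 0.
have s0 : 0 < s.
  have := Gpos (row_mx 1%:M w); rewrite row_mx_eq0 negb_and.
  have -> : (1%:M : 'M[R]_1) != 0 by apply/eqP => /matrixP/(_ 0 0)/eqP; rewrite !mxE oner_eq0.
  by rewrite val !mul1mx wr mul0mx addr0 trmx1 mulmx1; apply.
pose p := (Num.sqrt s)^-1.
have ps : p * s * p = 1.
  have q0 : Num.sqrt s != 0 by rewrite gt_eqF // sqrtr_gt0.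
  by rewrite /p -{2}(sqr_sqrtr (ltW s0)); field.
exists (block_mx p%:M (p *: w) 0 P1); split; last first.
  move=> i j; case: (split_ordP i) => i' ->; case: (split_ordP j) => j' -> /=.
  - by rewrite !ord1.
  - by rewrite ord1.
  - by rewrite block_mxEdl mxE.
  - by rewrite ltn_add2l block_mxEdr; exact: P1T.
rewrite GE tr_block_mx !mulmx_block !mul0mx !add0r trmx0 !mulmx0 !add0r.
have e1 : p%:M *m r + (p *: w) *m G1 = 0.
  by rewrite mul_scalar_mx -scalemxAl -scalerDr wr scaler0.
have e2 : r^T + G1 *m w^T = 0 by rewrite -G1T -trmx_mul -linearD wr linear0.
rewrite e1 !mul0mx addr0 P1E.
have -> : P1 *m r^T *m p%:M^T + P1 *m G1 *m (p *: w)^T = 0.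
  rewrite tr_scalar_mx linearZ /= -scalemxAr mul_mx_scalar -scalerDr -mulmxA.
  by rewrite -mulmxDr e2 mulmx0 scaler0.
rewrite tr_scalar_mx [RHS]scalar_mx_block; congr block_mx.
apply/matrixP => i j; rewrite !ord1 mul_scalar_mx -scalemxAl -scalerDr.
by rewrite mul_mx_scalar [LHS]mxE [X in _ * X]mxE -/s [RHS]mxE eqxx -[RHS]ps; ring.
Qed.

Lemma upper_orthonormal_basis n (G : 'M[R]_n) : posdef G ->
  exists P, upper_orthonormal G P.
Proof.
elim: n G => [|n IH] G Gpos.
  by exists 1%:M; split=> [|[]//]; apply/matrixP => -[].
exact: (@upper_orthonormal_step n).
Qed.

End Orthonormalization.

(** * A lower bound for compatible metrics in terms of scalar curvature *)

Section Minimality.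
Variable R : realType.
Notation V := 'rV[R]_6.
Implicit Types (a b c : R) (x y z : V) (nu : V -> V -> V).

Definition sgn6 : 'M[R]_6 := diag6 [:: 1; 1; 1; -1; -1; -1].

Lemma sgn6_block : sgn6 = block_mx 1%:M 0 0 (- 1%:M) :> 'M[R]_(3 + 3).
Proof.
have l3 (i : 'I_3) : [:: 1; 1; 1; -1; -1; -1]`_i = 1 :> R by case: i => [[|[|[|]]]].
have r3 (i : 'I_3) : [:: -1; -1; -1]`_i = -1 :> R.
  by case: i => [[|[|[|]]]].
apply/matrixP => i j.
case: (split_ordP i) => i' ->; case: (split_ordP j) => j' ->.
- by rewrite block_mxEul [LHS]mxE [X in X *+ _]mxE -val_eqE /= l3 mxE.
- rewrite block_mxEur [LHS]mxE -val_eqE /= ltn_eqF ?mulr0n ?mxE //.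
  exact: leq_trans (ltn_ord i') (leq_addr _ _).
- rewrite block_mxEdl [LHS]mxE -val_eqE /= gtn_eqF ?mulr0n ?mxE //.
  exact: leq_trans (ltn_ord j') (leq_addr _ _).
- rewrite block_mxEdr [LHS]mxE [X in X *+ _]mxE -val_eqE /= eqn_add2l r3 !mxE.
  by rewrite mulNrn.
Qed.

(** With a zero lower right block, [J *m J = - 1%:M] makes the upper right block invertible and then
    the upper left one zero. So [J] exchanges the two eigenspaces of [sgn6] and anticommutes with
    it. *)
Lemma complex_structure_sgn6 (J : 'M[R]_6) : J *m J = - 1%:M ->
  drsubmx (J : 'M[R]_(3 + 3)) = 0 -> J *m sgn6 *m J = sgn6.
Proof.
rewrite -[6%N]/(3 + 3)%N in J *; move=> JJ J0; move: JJ; rewrite -(submxK J) J0 sgn6_block.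
move: (ulsubmx J) (ursubmx J) (dlsubmx J) => A B C.
have -> : - 1%:M = block_mx (- 1%:M) 0 0 (- 1%:M) :> 'M[R]_(3 + 3).
  by rewrite [in LHS]scalar_mx_block opp_block_mx !oppr0.
rewrite mulmx_block !mulmx0 !addr0 => /eq_block_mx [_ AB _ CB].
have BC : B *m C = - 1%:M.
  have := mulmx1C (_ : (- C) *m B = 1%:M).
  by rewrite mulNmx CB opprK mulmxN => /(_ erefl) <-; rewrite opprK.
have A0 : A = 0.
  by rewrite -[A]opprK -[X in - X]mulmx1 -mulmxN -BC mulmxA mulNmx AB oppr0 mul0mx.
rewrite A0 !mulmx_block !mulmx0 !mul0mx !addr0 !add0r !mulmx1 !mulmxN !mulmx1.
by rewrite !mulNmx BC CB opprK !mul0mx.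
Qed.

Definition sg (i : 'I_6) : R := [:: 1; 1; 1; -1; -1; -1]`_i.

(** Says that [sc nu i j k] vanishes unless [i] is among the first three indices and [k] among the
    last three, in a form that absorbs signs inside sums. *)
Definition adapted (nu : V -> V -> V) : Prop := forall i j k,
  sg i * sc nu i j k = sc nu i j k /\ sg k * sc nu i j k = - sc nu i j k.

Lemma mxtrace_mul_sgn6 (M : 'M[R]_6) : \tr (M *m sgn6) = \sum_i sg i * M i i.
Proof.
by rewrite /sgn6 /diag6 mul_mx_diag; apply: eq_bigr => i _; rewrite !mxE mulrC.
Qed.

(** The signs keep the sum with coefficient -1/2 and flip the one with coefficient 1/4: the total is
    -3/4 of the squared norm, against -1/4 for the scalar curvature. *)
Lemma trace_Ric_sgn6 nu : lie_bracket nu -> nilpotent nu -> adapted nu ->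
  \tr (Ric nu ip0 *m sgn6) = 3 * \tr (Ric nu ip0).
Proof.
move=> nul nun nua.
pose n1 i := \sum_k \sum_l sc nu i k l * sc nu i k l.
pose n2 i := \sum_k \sum_l sc nu k l i * sc nu k l i.
have RE i : Ric nu ip0 i i = - 2^-1 * n1 i + 4^-1 * n2 i by rewrite Ric_nilpotent.
have e1 i : sg i * n1 i = n1 i.
  rewrite /n1 mulr_sumr; apply: eq_bigr => k _; rewrite mulr_sumr.
  by apply: eq_bigr => l _; rewrite mulrA (nua i k l).1.
have e2 i : sg i * n2 i = - n2 i.
  rewrite /n2 mulr_sumr -sumrN; apply: eq_bigr => k _; rewrite mulr_sumr -sumrN.
  by apply: eq_bigr => l _; rewrite mulrA (nua k l i).2 mulNr.
rewrite -[\tr (Ric nu ip0)]/(scal nu ip0) scal_nilpotent // mxtrace_mul_sgn6.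
transitivity (\sum_i (- 2^-1 * n1 i - 4^-1 * n2 i)).
  apply: eq_bigr => i _; rewrite RE mulrDr !(mulrCA (sg i)) e1 e2; ring.
rewrite big_split /= sumrN -!mulr_sumr -normsqE -normsq_exchange; by field.
Qed.

Lemma trace_sqr_ge0 (M : 'M[R]_6) : M^T = M -> 0 <= \tr (M *m M).
Proof.
move=> MT; rewrite -{2}MT trace_mulmx_tr; apply: sumr_ge0 => i _.
by apply: sumr_ge0 => j _; rewrite -expr2 sqr_ge0.
Qed.

Lemma Ric_sym nu : lie_bracket nu -> nilpotent nu -> (Ric nu ip0)^T = Ric nu ip0.
Proof.
move=> nul nun; apply/matrixP => i j; rewrite mxE !Ric_nilpotent //.
by congr (_ * _ + _ * _); apply: eq_bigr => k _; apply: eq_bigr => l _; rewrite mulrC.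
Qed.

Lemma mxtrace_anticomplexified (J M K : 'M[R]_6) : J *m K *m J = K ->
  \tr (2^-1 *: (M + J *m M *m J) *m K) = \tr (M *m K).
Proof.
move=> JK; rewrite -scalemxAl mxtraceZ mulmxDl mxtraceD -!mulmxA (mxtrace_mulC J).
by rewrite -!mulmxA (mulmxA J K) JK; field.
Qed.

(* Cauchy-Schwarz against sgn6, with which the Ricci operator and its
   anti-complexification have the same trace. *)
Lemma adapted_bound nu (J : 'M[R]_6) : lie_bracket nu -> nilpotent nu ->
  adapted nu -> J^T = - J -> J *m sgn6 *m J = sgn6 ->
  3 / 2 * \tr (Ric nu ip0) ^+ 2
    <= tr_sq (2^-1 *: (Ric nu ip0 + J *m Ric nu ip0 *m J)).
Proof.
move=> nul nun nua JT JK; rewrite /tr_sq.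
move: (Ric nu ip0) (trace_Ric_sgn6 nul nun nua) (Ric_sym nul nun) => r rK rT.
set A := 2^-1 *: _.
have trAK : \tr (A *m sgn6) = 3 * \tr r by rewrite /A mxtrace_anticomplexified.
have AT : A^T = A.
  rewrite /A linearZ /= linearD /= !trmx_mul JT rT.
  by rewrite mulNmx !mulmxN opprK mulmxA.
have KT : sgn6^T = sgn6 by rewrite /sgn6 /diag6 tr_diag_mx.
have KK : \tr (sgn6 *m sgn6) = 6.
  rewrite (mxtrace_mul_sgn6 sgn6) sum6 /sg /sgn6 !diag6E // !inordK //=; ring.
(* [l] is the coefficient of the orthogonal projection of [A] on [sgn6], namely [3 * \tr r / 6]. *)
move: A trAK AT => A trAK AT; pose l := \tr r / 2.
have MT : (A - l *: sgn6)^T = A - l *: sgn6 by rewrite [LHS]raddfB /= linearZ /= AT KT.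
have := trace_sqr_ge0 MT.
rewrite mulmxBl !mulmxBr !mxtraceB -!(scalemxAl, scalemxAr) !mxtraceZ.
rewrite (mxtrace_mulC sgn6 A) trAK KK /l.
set x := \tr (A *m A); set y := \tr _.
have -> : x - y / 2 * (3 * y) - (y / 2 * (3 * y) - y / 2 * (y / 2 * 6)) =
  x - 3 / 2 * y ^+ 2 by field.
by rewrite subr_ge0.
Qed.

Lemma trmx_form_omega : (form_mx (@omega R))^T = - form_mx (@omega R).
Proof. by apply/matrixP => i j; rewrite !mxE /omega /wedge; ring. Qed.

Lemma form_omegaE (i j : 'I_6) : form_mx (@omega R) i j =
  if (i + j == 5)%N then (if (i < 3)%N then 1 else -1) else 0.
Proof. by rewrite -{1}(inord_val i) -{1}(inord_val j) omega_delta. Qed.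

Lemma form_omega_block :
  exists W W' : 'M[R]_3, form_mx (@omega R) = block_mx 0 W W' 0 :> 'M[R]_(3 + 3).
Proof.
pose O : 'M[R]_(3 + 3) := form_mx omega.
exists (ursubmx O), (dlsubmx O); rewrite -[LHS](@submxK _ 3 3 3 3).
congr block_mx; apply/matrixP => i j; rewrite [RHS]mxE.
  transitivity (O (lshift 3 i) (lshift 3 j)); first by rewrite 2!mxE.
  rewrite /O form_omegaE /=; case: eqP => // e.
  by have := ltn_ord i; have := ltn_ord j; lia.
transitivity (O (rshift 3 i) (rshift 3 j)); first by rewrite 2!mxE.
by rewrite /O form_omegaE /=; case: eqP => // e; lia.
Qed.

Lemma conj_lie_bracket (mu : V -> V -> V) (P : 'M[R]_6) : P \in unitmx ->
  lie_bracket mu -> lie_bracket (fun x y => mu (x *m P) (y *m P) *m invmx P).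
Proof.
move=> uP [ll lr alt jac].
have {}ll k u v w : mu (k *: u + v) w = k *: mu u w + mu v w by exact: ll.
have {}lr k u v w : mu w (k *: u + v) = k *: mu w u + mu w v by exact: lr.
split=> [y k x z|x k y z|x|x y z].
- by rewrite mulmxDl -scalemxAl ll mulmxDl -scalemxAl.
- by rewrite mulmxDl -scalemxAl lr mulmxDl -scalemxAl.
- by rewrite alt mul0mx.
- by rewrite !mulmxKV // -!mulmxDl jac mul0mx.
Qed.

(* [lsubmx x = 0] says that x lies in the Lagrangian subspace spanned by
   X_4, X_5, X_6. *)
Lemma compatible_bound (mu : V -> V -> V) G : lie_bracket mu ->
  (forall x y z, mu x (mu y z) = 0) ->
  (forall x y, lsubmx (x : 'rV[R]_(3 + 3)) = 0 -> mu x y = 0) ->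
  (forall x y, lsubmx (mu x y : 'rV[R]_(3 + 3)) = 0) ->
  compatible omega G ->
  3 / 2 * scal mu G ^+ 2 <= tr_sq (Ric_ac omega mu G).
Proof.
move=> mul mu2 mu_z mu_d [Gip JJ]; have uG := pos_unitmx Gip; have [GT Gpos] := Gip.
have [P [PE PT]] := upper_orthonormal_basis (conj GT Gpos).
have uP : P \in unitmx by rewrite -mulmxA in PE; have [] := mulmx1_unit PE.
have mub := lie_bracket_bil mul.
(* The bracket read in the orthonormal basis [P], where the metric becomes the standard one. *)
pose nu x y := mu (x *m P) (y *m P) *m invmx P.
have nuE x y : mu (x *m P) (y *m P) = nu x y *m P by rewrite /nu mulmxKV.
have nul : lie_bracket nu by exact: conj_lie_bracket.
have nun : nilpotent nu.
  exists 2 => -[|x [|y [|]]] // z _ /=.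
  by rewrite /nu mulmxKV // mu2 mul0mx.
have nub := lie_bracket_bil nul.
have RicE : P *m Ric mu G = Ric nu ip0 *m P.
  rewrite -[ip0]/(1%:M) -PE; apply: Ric_conj => //.
  exact: curvature_conj.
have uG' : invmx G = P^T *m P.
  apply: (can_inj (mulKmx uG)); rewrite mulmxV //.
  by rewrite mulmxA; apply/esym/mulmx1C; rewrite mulmxA.
pose J := (P *m form_mx omega *m P^T)^T.
have JE : P *m Jmx omega G = J *m P.
  rewrite /Jmx /J !trmx_mul uG' trmx_mul !trmxK.
  by rewrite trmx_form_omega !(mulNmx, mulmxN) !mulmxA.
have JT : J^T = - J.
  by rewrite /J !trmx_mul !trmxK trmx_form_omega mulNmx mulmxN opprK mulmxA.
have J2 : J *m J = - 1%:M.
  apply: (can_inj (mulmxK uP)); rewrite -mulmxA -JE mulmxA -JE -mulmxA JJ.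
  by rewrite mulmxN mulNmx mulmx1 mul1mx.
have [A [B [D PB]]] : exists A B D : 'M[R]_3, P = block_mx A B 0 D :> 'M[R]_(3 + 3).
  pose Q : 'M[R]_(3 + 3) := P.
  exists (ulsubmx Q), (ursubmx Q), (drsubmx Q); rewrite -[LHS](@submxK _ 3 3 3 3).
  congr block_mx; apply/matrixP => i j; rewrite [RHS]mxE.
  transitivity (Q (rshift 3 i) (lshift 3 j)); first by rewrite 2!mxE.
  by rewrite /Q PT //=; have := ltn_ord j; lia.
(* Since [P] is block upper triangular, the form read in the new basis still vanishes on the last
   three vectors, so [J] has zero lower right block. *)
have JK : J *m sgn6 *m J = sgn6.
  apply: complex_structure_sgn6 => //.
  have [W [W' OE]] := form_omega_block.
  have -> : (J : 'M[R]_(3 + 3)) = (block_mx A B 0 D *m block_mx 0 W W' 0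
     *m (block_mx A B 0 D)^T)^T by rewrite /J PB OE.
  rewrite tr_block_mx !mulmx_block tr_block_mx block_mxKdr.
  by rewrite !(mul0mx, mulmx0, trmx0, addr0).
have nua : adapted nu.
  have uA : A \in unitmx.
    have := uP; rewrite !unitmxE PB (det_ublock A B D) unitrM => /andP[uA _].
    exact: uA.
  move=> i j k; split.
    have [i3|i3] := ltnP i 3.
      by rewrite /sg; case: i i3 => [[|[|[|]]]] //= *; rewrite mul1r.
    suff -> : sc nu i j k = 0 by rewrite mulr0.
    rewrite /sc /nu mu_z ?mul0mx ?mxE //.
    apply/rowP => l; rewrite [RHS]mxE mxE -rowE mxE PT //=.
    exact: leq_trans (ltn_ord l) i3.
  have [k3|k3] := ltnP k 3; last first.
    rewrite /sg; case: k k3 => [[|[|[|[|[|[|]]]]]]] //= *; rewrite ?mulN1r //.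
  suff -> : sc nu i j k = 0 by rewrite mulr0 oppr0.
  have := mu_d (delta_mx 0 i *m P) (delta_mx 0 j *m P); rewrite nuE.
  rewrite /sc; move: (nu _ _) => w.
  rewrite PB -[w](@hsubmxK _ 1 3 3) (@mul_row_block _ 1 3 3 3 3) (@row_mxKl _ 1 3 3).
  rewrite mulmx0 addr0 => wA.
  have w0 : lsubmx (w : 'rV[R]_(3 + 3)) = 0.
    by apply: (can_inj (mulmxK uA)); rewrite wA mul0mx.
  rewrite w0 (_ : k = lshift 3 (Ordinal k3)); last exact: val_inj.
  by rewrite (@row_mxEl _ 1 3 3) mxE.
have RE : Ric mu G = invmx P *m Ric nu ip0 *m P by rewrite -mulmxA -RicE mulKmx.
have JE' : Jmx omega G = invmx P *m J *m P by rewrite -mulmxA -JE mulKmx.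
have acE : Ric_ac omega mu G = invmx P *m
    (2^-1 *: (Ric nu ip0 + J *m Ric nu ip0 *m J)) *m P.
  rewrite /Ric_ac RE JE' -scalemxAr -scalemxAl mulmxDr mulmxDl -!mulmxA.
  by rewrite !(mulmxA P (invmx P)) mulmxV // !mul1mx.
have -> : scal mu G = \tr (Ric nu ip0).
  by rewrite /scal RE -mulmxA mxtrace_mulC -mulmxA mulmxV // mulmx1.
have -> : tr_sq (Ric_ac omega mu G) =
    tr_sq (2^-1 *: (Ric nu ip0 + J *m Ric nu ip0 *m J)).
  rewrite /tr_sq acE -!mulmxA mxtrace_mulC -!mulmxA.
  by rewrite !(mulmxA P (invmx P)) mulmxV // mulmx1 !mul1mx.
exact: adapted_bound.
Qed.

End Minimality.

(** * Critical points *)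

Section RealDerivatives.
Variable R : realType.
Implicit Types (f g : R -> R) (x : R).

Lemma is_derive_bigsum n (h : 'I_n -> R -> R) (dh : 'I_n -> R) x :
  (forall i, is_derive x (1 : R) (h i) (dh i)) ->
  is_derive x (1 : R) (fun r => \sum_i h i r) (\sum_i dh i).
Proof.
move=> dhi; rewrite (_ : (fun r => _) = \sum_i h i); first exact: is_derive_sum.
by apply/funext => r; rewrite fct_sumE.
Qed.

Lemma is_derive_mul f g (df dg : R) x :
  is_derive x (1 : R) f df -> is_derive x (1 : R) g dg ->
  is_derive x (1 : R) (fun r => f r * g r) (f x * dg + g x * df).
Proof. exact: is_deriveM. Qed.

Lemma is_derive_scale k f (df : R) x : is_derive x (1 : R) f df ->
  is_derive x (1 : R) (fun r => k * f r) (k * df).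
Proof. exact: is_deriveZ. Qed.

Lemma is_derive_add f g (df dg : R) x :
  is_derive x (1 : R) f df -> is_derive x (1 : R) g dg ->
  is_derive x (1 : R) (fun r => f r + g r) (df + dg).
Proof. exact: is_deriveD. Qed.

Lemma is_derive_const (k x : R) : is_derive x (1 : R) (fun=> k) 0.
Proof. exact: (is_derive_cst k x (1 : R)). Qed.

Lemma is_derive_quotient f g (df dg : R) x : g x != 0 ->
  is_derive x (1 : R) f df -> is_derive x (1 : R) g dg ->
  is_derive x (1 : R) (fun r => f r / g r) (df / g x - f x * dg / g x ^+ 2).
Proof.
move=> gx0 fd gd.
apply: (is_derive_eq (is_derive_mul fd (is_deriveV gx0 gd))).
by rewrite /GRing.scale /=; field.
Qed.

End RealDerivatives.

(** * Minimality of the standard metric and the derivative of the functional along curves of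
    brackets *)

Section CriticalPoints.
Variable R : realType.
Notation V := 'rV[R]_6.
Implicit Types (a b c : R) (x y z : V).

Lemma tr_sq_Ric_ac_mu_abc a b c : tr_sq (Ric_ac omega (mu_abc a b c) ip0) =
  3 / 8 * (a ^+ 2 + b ^+ 2 + c ^+ 2) ^+ 2.
Proof.
rewrite Ric_ac_mu_abc /tr_sq -/(sgn6 R) -scalemxAl -scalemxAr scalerA mxtraceZ.
by rewrite mxtrace_mul_sgn6 sum6 /sg /sgn6 !diag6E // !inordK //=; field.
Qed.

Lemma low_alpha x i : lsubmx (x : 'rV[R]_(3 + 3)) = 0 -> (0 < i <= 3)%N ->
  alpha i x = 0.
Proof.
move=> x0; case: i => // i /= li.
have -> : alpha i.+1 x = lsubmx (x : 'rV[R]_(3 + 3)) 0 (Ordinal li).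
  rewrite mxE /alpha; congr (x 0 _); apply/val_inj; rewrite /= inordK //.
  exact: leq_trans li _.
by rewrite x0 mxE.
Qed.

(** The scalar curvature is [- S / 2] with [S = a ^+ 2 + b ^+ 2 + c ^+ 2], so the bound is
    [3 / 8 * S ^+ 2], the value attained by the standard metric. *)
Lemma minimal_mu_abc a b c : minimal omega (mu_abc a b c) ip0.
Proof.
split; first exact: compatible_omega_ip0.
move=> G cG sG; rewrite tr_sq_Ric_ac_mu_abc.
have z0 x y : lsubmx (x : 'rV[R]_(3 + 3)) = 0 -> mu_abc a b c x y = 0.
  move=> x0; apply: alpha_inj => i li.
  by rewrite alpha_mu // /wedge !(low_alpha x0) // alpha0; ring.
have d0 x y : lsubmx (mu_abc a b c x y : 'rV[R]_(3 + 3)) = 0.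
  apply/rowP => j; rewrite [RHS]mxE.
  transitivity (alpha j.+1 (mu_abc a b c x y)).
    rewrite mxE /alpha; congr (mu_abc a b c x y 0 _); apply/val_inj.
    by rewrite /= inordK //; exact: leq_trans (ltn_ord j) _.
  rewrite alpha_mu; last by exact: leq_trans (ltn_ord j) _.
  by case: j => [[|[|[|]]]] //= _; ring.
have := compatible_bound (mu_abc_lie a b c) (@mu_abc_two_step R a b c) z0 d0 cG.
rewrite sG scal_mu_abc; apply: le_trans.
by rewrite le_eqVlt; apply/orP; left; apply/eqP; field.
Qed.

Lemma adapted_mu_abc a b c : adapted (mu_abc a b c).
Proof.
move=> i j k; move: i j k.
apply: ord6_ind => i li; apply: ord6_ind => j lj; apply: ord6_ind => k lk.
rewrite sc_mu_abc // /sg !inordK //.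
move: i j k {li lj lk} => [|[|[|i]]] [|[|[|j]]] [|[|[|[|[|[|k]]]]]] /=; split; ring.
Qed.

Lemma in_PNs_mu_abc a b c : (a, b, c) <> (0, 0, 0) -> a - b + c = 0 ->
  in_PNs omega (mu_abc a b c).
Proof.
move=> nz abc; split.
  split; [exact: mu_abc_lie|exact: mu_abc_nilpotent|exact/closed_mu_abc].
move=> mu0; apply: nz.
have e i j k : (0 < i <= 6)%N -> alpha i (mu_abc a b c (X j) (X k)) = 0.
  by move=> _; rewrite mu0 alpha0.
have := e 4%N 1%N 2%N isT; have := e 5%N 1%N 3%N isT; have := e 6%N 2%N 3%N isT.
rewrite !alpha_mu // /wedge !alphaX //= => c0 b0 a0.
by congr (_, _, _); lra.
Qed.

(** With [N] the value of [M] at the base point, [tr_sq (M - N)] is of second order and only the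
    linear term contributes to the derivative. *)
Lemma tr_sq_shift (M N : 'M[R]_6) :
  tr_sq M = tr_sq (M - N) + 2 * \tr (N *m M) - tr_sq N.
Proof.
rewrite /tr_sq mulmxBl !mulmxBr !mxtraceB (mxtrace_mulC M N); ring.
Qed.

Section Curve.
Variables (a b c : R) (cv : R -> V -> V -> V).
Hypotheses (cv0 : cv 0 = mu_abc a b c).
Hypothesis dcv : forall x y, derivable (fun r => cv r x y) 0 1.

Let g i j k (r : R) : R := sc (cv r) i j k.
Let dg i j k : R := 'D_1 (g i j k) 0.
Let w i j k : R := g i j k 0 * dg i j k.
Let W : R := \sum_i \sum_j \sum_k w i j k.

Let gD i j k : is_derive (0 : R) (1 : R) (g i j k) (dg i j k).
Proof.
apply: derivableP.
exact: ((derivable_mxP _ _ _).1 (@dcv (delta_mx 0 i) (delta_mx 0 j)) 0 k).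
Qed.

Let g0 i j k : g i j k 0 = sc (mu_abc a b c) i j k.
Proof. by rewrite /g cv0. Qed.

(** The Ricci operator as a polynomial in the structure constants, defined for every [r]; it is the
    geometric one wherever [cv r] is a nilpotent Lie bracket. *)
Let ric i j (r : R) : R := - 2^-1 * (\sum_k \sum_l g i k l r * g j k l r)
    + 4^-1 * (\sum_k \sum_l g k l i r * g k l j r).

Let dric i j : R :=
  - 2^-1 * (\sum_k \sum_l (g i k l 0 * dg j k l + g j k l 0 * dg i k l))
  + 4^-1 * (\sum_k \sum_l (g k l i 0 * dg k l j + g k l j 0 * dg k l i)).

Let ricD i j : is_derive (0 : R) (1 : R) (ric i j) (dric i j).
Proof.
apply: is_derive_add; apply: is_derive_scale; apply: is_derive_bigsum => k;
  apply: is_derive_bigsum => l; exact: is_derive_mul.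
Qed.

Let n (r : R) : R := \sum_i \sum_j \sum_k g i j k r * g i j k r.

Let nE r : normsq (cv r) = n r.
Proof. exact: normsqE. Qed.

Let nD : is_derive (0 : R) (1 : R) n (2 * W).
Proof.
rewrite (_ : 2 * W = \sum_i \sum_j \sum_k (w i j k + w i j k)).
  do 3!apply: is_derive_bigsum => ?; exact: is_derive_mul.
rewrite /W mulr_sumr; apply: eq_bigr => i _; rewrite mulr_sumr.
apply: eq_bigr => j _; rewrite mulr_sumr; apply: eq_bigr => k _.
by rewrite mulr2n mulrDl mul1r.
Qed.

Let n0 : n 0 = 2 * (a ^+ 2 + b ^+ 2 + c ^+ 2).
Proof.
have := scal_nilpotent (mu_abc_lie a b c) (mu_abc_nilpotent a b c).
rewrite scal_mu_abc -nE cv0; lra.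
Qed.

Let q (r : R) : R := \sum_i sg R i * ric i i r.

(** First-order version of [trace_Ric_sgn6]: each derivative term carries a structure constant of
    [mu_abc], which absorbs the sign. The result is -3/4 of the derivative [2 * W] of the squared
    norm. *)
Let qD : is_derive (0 : R) (1 : R) q (- (3 / 2) * W).
Proof.
pose w1 i := \sum_k \sum_l w i k l; pose w2 i := \sum_k \sum_l w k l i.
have e1 i : sg R i * w1 i = w1 i.
  rewrite /w1 mulr_sumr; apply: eq_bigr => k _; rewrite mulr_sumr.
  by apply: eq_bigr => l _; rewrite /w mulrA g0 (adapted_mu_abc a b c i k l).1.
have e2 i : sg R i * w2 i = - w2 i.
  rewrite /w2 mulr_sumr -sumrN; apply: eq_bigr => k _; rewrite mulr_sumr -sumrN.
  by apply: eq_bigr => l _; rewrite /w mulrA g0 (adapted_mu_abc a b c k l i).2 mulNr.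
have W2 : W = \sum_i w2 i.
  rewrite /W /w2 [RHS]exchange_big; apply: eq_bigr => k _.
  by rewrite [RHS]exchange_big.
have dbl (f : 'I_6 -> 'I_6 -> R) : \sum_k \sum_l (f k l + f k l) =
    2 * \sum_k \sum_l f k l.
  rewrite mulr_sumr; apply: eq_bigr => k _; rewrite mulr_sumr.
  by apply: eq_bigr => l _; rewrite mulr2n mulrDl mul1r.
rewrite (_ : - (3 / 2) * W = \sum_i sg R i * (- 2^-1 * (2 * w1 i) + 4^-1 * (2 * w2 i))).
  apply: is_derive_bigsum => i; apply: is_derive_scale; rewrite -!dbl.
  exact: ricD.
transitivity (\sum_i (- w1 i - 2^-1 * w2 i)); last first.
  apply: eq_bigr => i _; rewrite mulrDr !(mulrCA (sg R i)) e1 e2; by field.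
rewrite big_split /= !sumrN -mulr_sumr -W2 -/W; by field.
Qed.

Let Rm (r : R) : 'M[R]_6 := \matrix_(i, j) ric i j r.
Let J : 'M[R]_6 := Jmx omega ip0.
Let M (r : R) : 'M[R]_6 := 2^-1 *: (Rm r + J *m Rm r *m J).

Let MD i j : exists m, is_derive (0 : R) (1 : R) (fun r => M r i j) m.
Proof.
have E : (fun r => M r i j) = (fun r => 2^-1 * (ric i j r
    + \sum_l (J l j * \sum_k (J i k * ric k l r)))).
  apply/funext => r; rewrite mxE [X in _ * X]mxE [X in _ * (X + _)]mxE; congr (_ * (_ + _)).
  rewrite mxE; apply: eq_bigr => l _; rewrite mulrC; congr (_ * _).
  by rewrite mxE; apply: eq_bigr => k _; congr (_ * _); rewrite mxE.
rewrite E; exists (2^-1 * (dric i j + \sum_l (J l j * \sum_k (J i k * dric k l)))).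
apply: is_derive_scale; apply: is_derive_add; first exact: ricD.
apply: is_derive_bigsum => l; apply: is_derive_scale.
apply: is_derive_bigsum => k; apply: is_derive_scale; exact: ricD.
Qed.

Let M_near : (\forall r \near (0 : R), in_PNs omega (cv r)) ->
  \forall r \near (0 : R), Ric_ac omega (cv r) ip0 = M r.
Proof.
apply: filterS => r [[lr nr _] _]; rewrite /Ric_ac /M -/J.
suff -> : Ric (cv r) ip0 = Rm r by [].
by apply/matrixP => i j; rewrite Ric_nilpotent // mxE.
Qed.

Let rho : 'M[R]_6 := Ric_ac omega (mu_abc a b c) ip0.

Let rhoE : rho = - (1 / 4 * (a ^+ 2 + b ^+ 2 + c ^+ 2)) *: sgn6 R.
Proof. exact: Ric_ac_mu_abc. Qed.

Let trM r : \tr (rho *m M r) = - (1 / 4 * (a ^+ 2 + b ^+ 2 + c ^+ 2)) * q r.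
Proof.
have JK : J *m sgn6 R *m J = sgn6 R.
  apply: complex_structure_sgn6; first exact: (compatible_omega_ip0 R).2.
  have [U [U' OE]] := form_omega_block R.
  have -> : (J : 'M[R]_(3 + 3)) = (block_mx 0 U U' 0)^T by rewrite /J Jmx_ip0 OE.
  by rewrite tr_block_mx block_mxKdr trmx0.
rewrite rhoE -scalemxAl mxtraceZ mxtrace_mulC (mxtrace_anticomplexified _ JK).
rewrite mxtrace_mul_sgn6 /q; congr (_ * _); apply: eq_bigr => i _.
by rewrite mxE.
Qed.

Lemma critical_curve : (a, b, c) <> (0, 0, 0) ->
  (\forall r \near (0 : R), in_PNs omega (cv r)) ->
  is_derive (0 : R) (1 : R) (fun r => F omega (cv r)) 0.
Proof.
move=> nz near_cv; have near_M := M_near near_cv.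
have M0 : M 0 = rho by rewrite /rho -cv0; apply/esym; exact: nbhs_singleton near_M.
set S := a ^+ 2 + b ^+ 2 + c ^+ 2.
have S0 : S != 0.
  apply/eqP => S0; apply: nz.
  have := sqr_ge0 a; have := sqr_ge0 b; have := sqr_ge0 c; rewrite /S in S0.
  move=> c0 b0 a0; congr (_, _, _); apply/eqP; rewrite -sqrf_eq0; apply/eqP; lra.
pose f r := tr_sq (M r - rho) + (2 * \tr (rho *m M r) + - tr_sq rho).
have fD : is_derive (0 : R) (1 : R) f (0 + (2 * (- (1 / 4 * S) * (- (3 / 2) * W)) + 0)).
  have D2 : is_derive (0 : R) (1 : R) (fun r => 2 * \tr (rho *m M r))
      (2 * (- (1 / 4 * S) * (- (3 / 2) * W))).
    apply: is_derive_scale.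
    have -> : (fun r => \tr (rho *m M r)) = (fun r => - (1 / 4 * S) * q r).
      by apply/funext => r; rewrite trM.
    exact: is_derive_scale.
  suff D1 : is_derive (0 : R) (1 : R) (fun r => tr_sq (M r - rho)) 0.
    exact: (is_derive_add D1 (is_derive_add D2 (is_derive_const _ _))).
  have -> : (fun r => tr_sq (M r - rho)) =
      (fun r => \sum_i \sum_j ((M r - rho) i j * (M r - rho) j i)).
    by apply/funext => r; apply: eq_bigr => i _; rewrite mxE.
  have z : \sum_(i < 6) \sum_(j < 6) (0 : R) = 0.
    by rewrite big1 // => i _; rewrite big1.
  suff : is_derive (0 : R) (1 : R)
      (fun r => \sum_i \sum_j ((M r - rho) i j * (M r - rho) j i))
      (\sum_(i < 6) \sum_(j < 6) (0 : R)) by rewrite z.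
  apply: is_derive_bigsum => i; apply: is_derive_bigsum => j.
  have Dd k l : exists2 m, is_derive (0 : R) (1 : R) (fun r => (M r - rho) k l) m
      & (M 0 - rho) k l = 0.
    have [m mD] := MD k l; exists (m + 0); last by rewrite M0 subrr mxE.
    have -> : (fun r => (M r - rho) k l) = (fun r => M r k l + - rho k l).
      by apply/funext => r; rewrite [LHS]mxE [X in _ + X]mxE.
    exact: (is_derive_add mD (is_derive_const _ _)).
  have [m mD m0] := Dd i j; have [m' m'D m'0] := Dd j i.
  (* Both factors vanish at 0, so the product rule gives zero. *)
  apply: (is_derive_eq (is_derive_mul mD m'D)).
  by rewrite m0 m'0 !mul0r addr0.
apply: (@near_eq_is_derive _ _ _ (fun r => f r / (n r * n r))).
  near=> r; rewrite /F nE expr2; congr (_ / _).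
  have -> : Ric_ac omega (cv r) ip0 = M r by near: r.
  by rewrite [RHS](tr_sq_shift (M r) rho) /f addrA.
have nnD := is_derive_mul nD nD.
have nn0 : n 0 * n 0 != 0 by rewrite n0 -/S !mulf_neq0.
have Q := @is_derive_quotient R f (fun r => n r * n r) _ _ 0 nn0 fD nnD.
apply: (is_derive_eq Q).
have -> : f 0 = 3 / 8 * S ^+ 2.
  by rewrite /f M0 addrA -tr_sq_shift /rho tr_sq_Ric_ac_mu_abc.
(* Here [f] is [3 / 8 * S ^+ 2] with derivative [3 / 4 * S * W], and [n * n] is [4 * S ^+ 2] with
   derivative [8 * S * W]; the two terms of the quotient rule cancel. *)
rewrite n0 -/S; by field.
Unshelve. all: by end_near. Qed.

End Curve.

Lemma critical_mu_abc a b c : (a, b, c) <> (0, 0, 0) -> a - b + c = 0 ->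
  critical_point omega (mu_abc a b c).
Proof.
move=> nz abc; split; first exact: in_PNs_mu_abc.
by move=> cv cv0 near_cv dcv; exact: (critical_curve cv0 dcv nz near_cv).
Qed.

End CriticalPoints.

Theorem mainTheorem2 (R : realType) :
  compatible (@omega R) ip0 /\
  (forall a b c : R,
     lie_bracket (mu_abc a b c) /\
     (forall x y z, mu_abc a b c x (mu_abc a b c y z) = 0)) /\
  (* (i) *)
  (forall a b c : R, closed_form omega (mu_abc a b c) <-> a - b + c = 0) /\
  (* (ii) *)
  (forall a b c : R,
     let S := a ^+ 2 + b ^+ 2 + c ^+ 2 in
     [/\ Ric_ac omega (mu_abc a b c) ip0
           = - (1 / 4 * S) *: diag6 [:: 1; 1; 1; -1; -1; -1],
         Ric_ac omega (mu_abc a b c) ip0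
           = - (3 / 4 * S) *: 1%:M + (1 / 2 * S) *: diag6 [:: 1; 1; 1; 2; 2; 2],
         derivation (mu_abc a b c) ((1 / 2 * S) *: diag6 [:: 1; 1; 1; 2; 2; 2]) &
         in_RI_plus_Der (mu_abc a b c) (Ric_ac omega (mu_abc a b c) ip0)]) /\
  (forall a b c : R, (a, b, c) <> (0, 0, 0) -> a - b + c = 0 ->
     critical_point omega (mu_abc a b c)) /\
  (* (iii) *)
  (forall a b c : R,
     a ^+ 2 + b ^+ 2 + c ^+ 2 = 2 <-> scal (mu_abc a b c) ip0 = -1) /\
  (forall a b c : R, a ^+ 2 + b ^+ 2 + c ^+ 2 = 2 ->
     [/\ X 4 *m Ric (mu_abc a b c) ip0 = (1 / 2 * a ^+ 2) *: X 4,
         X 5 *m Ric (mu_abc a b c) ip0 = (1 / 2 * b ^+ 2) *: X 5 &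
         X 6 *m Ric (mu_abc a b c) ip0 = (1 / 2 * c ^+ 2) *: X 6]) /\
  (forall a b c : R, a ^+ 2 + b ^+ 2 + c ^+ 2 = 2 -> a - b + c = 0 ->
     lie_center (mu_abc a b c)
       = [set x | exists p q r : R, x = p *: X 4 + q *: X 5 + r *: X 6]) /\
  (forall s t s' t' : R, on_curve s t -> on_curve s' t' -> t <> t' ->
     ~ isometric (mu_st s t) ip0 (mu_st s' t') ip0) /\
  (forall s t s' t' : R, on_curve s t -> on_curve s' t' -> t <> t' ->
     ~ symplectic_isomorphic (mu_st s t) omega (mu_st s' t') omega) /\
  (forall s t : R, on_curve s t ->
     Ns omega (mu_st s t) /\ exists G : 'M[R]_6, minimal omega (mu_st s t) G) /\
  (* (iv) *)
  (exists (nu : 'rV[R]_6 -> 'rV[R]_6 -> 'rV[R]_6) (E : 'M[R]_6),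
     let e := covec E in
     [/\ lie_bracket nu, E \in unitmx,
         [/\ d1 nu (e 1%N) = (fun _ _ => 0), d1 nu (e 2%N) = (fun _ _ => 0),
             d1 nu (e 3%N) = (fun _ _ => 0), d1 nu (e 4%N) = (fun _ _ => 0) &
             d1 nu (e 5%N) = wedge (e 1%N) (e 2%N) /\
             d1 nu (e 6%N) = wedge (e 1%N) (e 3%N)] &
         lie_isomorphic (mu_st 1 0) nu]) /\
  (forall s t : R, on_curve s t -> 0 < t ->
     exists (nu : 'rV[R]_6 -> 'rV[R]_6 -> 'rV[R]_6) (E : 'M[R]_6),
       let e := covec E in
       [/\ lie_bracket nu, E \in unitmx,
           [/\ d1 nu (e 1%N) = (fun _ _ => 0), d1 nu (e 2%N) = (fun _ _ => 0) &
               d1 nu (e 3%N) = (fun _ _ => 0)],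
           [/\ d1 nu (e 4%N) = wedge (e 1%N) (e 2%N), d1 nu (e 5%N) = wedge (e 1%N) (e 3%N) &
               d1 nu (e 6%N) = wedge (e 2%N) (e 3%N)] &
           lie_isomorphic (mu_st s t) nu]).
Proof.
split; first exact: compatible_omega_ip0.
split; first by move=> a b c; split; [exact: mu_abc_lie|exact: mu_abc_two_step].
split; first exact: closed_mu_abc.
split.
  move=> a b c S; split.
  - exact: Ric_ac_mu_abc.
  - by rewrite Ric_ac_mu_abc diag6_split.
  - exact: derivation_mu_abc.
  - exists (- (3 / 4 * S)), ((1 / 2 * S) *: diag6 [:: 1; 1; 1; 2; 2; 2]).
    split; first exact: derivation_mu_abc.
    by rewrite Ric_ac_mu_abc diag6_split scalemx1.
split; first exact: critical_mu_abc.
split; first by move=> a b c; rewrite scal_mu_abc; split=> ?; lra.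
split.
  move=> a b c _; rewrite div1r.
  by split; [exact: (@mul_X_Ric _ _ _ _ 4)|exact: (@mul_X_Ric _ _ _ _ 5)
            |exact: (@mul_X_Ric _ _ _ _ 6)].
split; first exact: center_mu_abc.
split; first exact: not_isometric_mu_st.
split; first exact: not_symplectic_isomorphic_mu_st.
split.
  move=> s t _; split; last by exists ip0; exact: minimal_mu_abc.
  split; [exact: mu_abc_lie|exact: mu_abc_nilpotent|].
  by apply/closed_mu_abc; ring.
split; first exact: mu_10_structure.
exact: mu_st_structure.
Qed.
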